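(* Let $\Omega=\Omega(u,v)$ be a solution in $E^4$ of the Betchov-Da Rios equation $\Omega_v=\Omega_u\times\Omega_{uu}\times\Omega_{uuu}$ whose $u$-parameter curves are unit speed, with ED$^2$-frame field $\{T,E,D,N\}$ and associated functions $\kappa,\sigma,\tau$ (notation and standing assumptions as in the context). Put $$P=\kappa^5\tau_u+2\kappa^4\tau\kappa_u-2\tau\kappa_u^3+2\kappa\kappa_u(\kappa_u\tau_u+2\tau\kappa_{uu})+\kappa^3\tau_{uuu}+\kappa^2(5\kappa_u\tau_{uu}+6\tau_u\kappa_{uu}+2\tau\kappa_{uuu}).$$ Then the invariants $k$ and $h$ of the soliton surface $S:\Omega=\Omega(u,v)$ are $$k=\frac{-1}{\kappa^6\tau^4}\Big(6\kappa^5\tau\sigma^3\sigma_u(3\kappa\tau_u+5\tau\kappa_u)+\kappa^4\sigma^4\big(4\kappa^2\tau^4+9\kappa^2\tau_u^2+30\kappa\tau\kappa_u\tau_u+25\tau^2\kappa_u^2\big)-6\kappa^3\tau\sigma\sigma_u P+P^2-\kappa^2\sigma^2 R\Big),$$ where $$R=4\kappa^3\tau^3(4\kappa_u\tau_u+\kappa\tau_{uu})+8\kappa^2\tau^4(\kappa_u^2+\kappa\kappa_{uu})$$ $$+6\kappa^2\tau_u\big(\kappa^4\tau_u+2\kappa_u^2\tau_u+\kappa^2\tau_{uuu}+\kappa(5\kappa_u\tau_{uu}+6\tau_u\kappa_{uu})\big)$$ $$+\tau^2\big(-20\kappa_u^4-\kappa^4(9\sigma_u^2-20\kappa_u^2)+40\kappa\kappa_u^2\kappa_{uu}+20\kappa^2\kappa_u\kappa_{uuu}\big)$$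 $$+2\kappa\tau\big(11\kappa^4\kappa_u\tau_u+4\kappa_u^3\tau_u+\kappa\kappa_u(25\kappa_u\tau_{uu}+42\tau_u\kappa_{uu})+\kappa^2(5\kappa_u\tau_{uuu}+6\tau_u\kappa_{uuu})\big),$$ and $$h=\frac{\sigma\Big(\big(-\kappa^2\sigma^2+\kappa^4+2\kappa_u^2+2\kappa\kappa_{uu}\big)\tau+\big(4\kappa_u\tau_u+\kappa\tau_{uu}\big)\kappa\Big)}{\kappa^3\tau}.$$
   Context: $E^4$ is Euclidean 4-space with inner product $\langle\cdot,\cdot\rangle$, and $x\times y\times z$ is the usual alternating ternary vector product of $E^4$ (with a fixed sign convention, e.g. $\langle w,x\times y\times z\rangle=\det(w,x,y,z)$). Subscripts $u,v$ denote partial derivatives. All functions are assumed sufficiently smooth on an open domain of the $(u,v)$-plane. ED$^2$-frame field: for each $v$, the unit speed curve $u\mapsto\Omega(u,v)$ lies on an oriented hypersurface of $E^4$; $T=\Omega_u$ and $N(u,v)$ is the unit normal of the hypersurface at $\Omega(u,v)$. One is in the case where $\{N,T,\Omega_{uu}\}$ is linearly dependent; $E$ is the normalization of $\Omega_{uuu}-\langle\Omega_{uuu},N\rangle N-\langle\Omega_{uuu},T\rangle T$ (assumed nonzero), and $D=N\times T\times E$. Associated functions: $\kappa=\kappa_n=\langle T_u,N\rangle$, $\sigma=\kappa_g^2=\langle E_u,D\rangle$ (the superscript in $\kappa_g^2$ is an index, not a power), $\tau=\tau_g^1=\langle E_u,N\rangle$. The frame satisfies $T_u=\kappa N$, $E_u=\sigma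 D+\tau N$, $D_u=-\sigma E$, $N_u=-\kappa T-\tau E$. Standing assumption: $\kappa$ and $\tau$ are nowhere zero. Invariants $k,h$: $\{E,N\}$ is the orthonormal normal frame of $S$. Let $g_{11}=\langle\Omega_u,\Omega_u\rangle$, $g_{12}=\langle\Omega_u,\Omega_v\rangle$, $g_{22}=\langle\Omega_v,\Omega_v\rangle$, and $\mathcal W=\kappa^2\tau$ (so $\mathcal W^2=g_{11}g_{22}-g_{12}^2$). Let $c_{11}^1=\langle\Omega_{uu},E\rangle$, $c_{12}^1=\langle\Omega_{uv},E\rangle$, $c_{22}^1=\langle\Omega_{vv},E\rangle$, and let $c_{ij}^2$ be the same with $N$ in place of $E$. Put $\Delta_1=c_{11}^1c_{12}^2-c_{12}^1c_{11}^2$, $\Delta_2=c_{11}^1c_{22}^2-c_{22}^1c_{11}^2$, $\Delta_3=c_{12}^1c_{22}^2-c_{22}^1c_{12}^2$, and $l_{11}=2\Delta_1/\mathcal W$, $l_{12}=\Delta_2/\mathcal W$, $l_{22}=2\Delta_3/\mathcal W$. The linear map $\gamma$ of the tangent plane has, with respect to $\Omega_u,\Omega_v$ ($\gamma(\Omega_u)=\gamma_1^1\Omega_u+\gamma_1^2\Omega_v$, $\gamma(\Omega_v)=\gamma_2^1\Omega_u+\gamma_2^2\Omega_v$), the entries $$\gamma_1^1=\frac{g_{12}l_{12}-g_{22}l_{11}}{\mathcal W^2},\ \gamma_1^2=\frac{g_{12}l_{11}-g_{11}l_{12}}{\mathcal W^2},\ \gamma_2^1=\frac{g_{12}l_{22}-g_{22}l_{12}}{\mathcal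 W^2},\ \gamma_2^2=\frac{g_{12}l_{12}-g_{11}l_{22}}{\mathcal W^2}.$$ Then $k=\det\gamma$ and $h=-\tfrac12\operatorname{tr}\gamma$. *)

(* Defs.v *)
(* Stdlib reals with Coquelicot. *)
From Stdlib Require Import Reals.
From Coquelicot Require Import Coquelicot.
Open Scope R_scope.

(* A product of copies of R, so that Coquelicot supplies the vector space
   operations, the topology and Frechet differentials. *)
Definition E4 : Type := (R * R * R * R)%type.

Definition x1 (x : E4) : R := fst (fst (fst x)).
Definition x2 (x : E4) : R := snd (fst (fst x)).
Definition x3 (x : E4) : R := snd (fst x).
Definition x4 (x : E4) : R := snd x.

Definition e1 : E4 := (1, 0, 0, 0).
Definition e2 : E4 := (0, 1, 0, 0).
Definition e3 : E4 := (0, 0, 1, 0).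
Definition e4 : E4 := (0, 0, 0, 1).

Definition dot (x y : E4) : R :=
  x1 x * x1 y + x2 x * x2 y + x3 x * x3 y + x4 x * x4 y.

(* The Euclidean norm; Coquelicot's [norm] on a product is not used. *)
Definition enorm (x : E4) : R := sqrt (dot x x).

Definition normalize (x : E4) : E4 := scal (/ enorm x) x.

Definition det3 (a1 a2 a3 b1 b2 b3 c1 c2 c3 : R) : R :=
  a1 * (b2 * c3 - b3 * c2) - a2 * (b1 * c3 - b3 * c1) + a3 * (b1 * c2 - b2 * c1).

(* Determinant of the matrix with rows w, x, y, z, expanded along w. *)
Definition det4 (w x y z : E4) : R :=
    x1 w * det3 (x2 x) (x3 x) (x4 x) (x2 y) (x3 y) (x4 y) (x2 z) (x3 z) (x4 z)
  - x2 w * det3 (x1 x) (x3 x) (x4 x) (x1 y) (x3 y) (x4 y) (x1 z) (x3 z) (x4 z)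
  + x3 w * det3 (x1 x) (x2 x) (x4 x) (x1 y) (x2 y) (x4 y) (x1 z) (x2 z) (x4 z)
  - x4 w * det3 (x1 x) (x2 x) (x3 x) (x1 y) (x2 y) (x3 y) (x1 z) (x2 z) (x3 z).

(* Sign convention: dot w (cross x y z) = det4 w x y z for all w. *)
Definition cross (x y z : E4) : E4 :=
  (det4 e1 x y z, det4 e2 x y z, det4 e3 x y z, det4 e4 x y z).

Definition lin_dep3 (x y z : E4) : Prop :=
  exists a b c : R, (a <> 0 \/ b <> 0 \/ c <> 0) /\
    plus (plus (scal a x) (scal b y)) (scal c z) = zero.

Definition du (f : R -> R -> R) (u v : R) : R := Derive (fun s => f s v) u.
Definition dv (f : R -> R -> R) (u v : R) : R := Derive (fun t => f u t) v.

Definition coord (i : E4 -> R) (f : R -> R -> E4) (u v : R) : R := i (f u v).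

Definition Du (f : R -> R -> E4) (u v : R) : E4 :=
  (du (coord x1 f) u v, du (coord x2 f) u v, du (coord x3 f) u v, du (coord x4 f) u v).
Definition Dv (f : R -> R -> E4) (u v : R) : E4 :=
  (dv (coord x1 f) u v, dv (coord x2 f) u v, dv (coord x3 f) u v, dv (coord x4 f) u v).

Fixpoint class_C (k : nat) (U : R * R -> Prop) (f : R -> R -> R) : Prop :=
  (forall u v, U (u, v) -> continuity_2d_pt f u v) /\
  match k with
  | O => True
  | S k' =>
      (forall u v, U (u, v) ->
         ex_derive (fun s => f s v) u /\ ex_derive (fun t => f u t) v) /\
      class_C k' U (du f) /\ class_C k' U (dv f)
  end.

Definition class_C_E4 (k : nat) (U : R * R -> Prop) (f : R -> R -> E4) : Prop :=
  class_C k U (coord x1 f) /\ class_C k U (coord x2 f) /\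
  class_C k U (coord x3 f) /\ class_C k U (coord x4 f).

(* M is a hypersurface of class C^1 oriented by the unit normal nu: near each of
   its points it is the zero set of a C^1 function F whose gradient G does not
   vanish and points in the direction nu. *)
Definition oriented_hypersurface (M : E4 -> Prop) (nu : E4 -> E4) : Prop :=
  forall p : E4, M p ->
    exists (V : E4 -> Prop) (F : E4 -> R) (G : E4 -> E4),
      open V /\ V p /\
      (forall x, V x ->
         filterdiff F (locally x) (fun y : E4 => dot (G x) y) /\
         continuous G x /\ G x <> zero /\
         (M x <-> F x = 0) /\
         (M x -> nu x = normalize (G x))).

(* N is part of the data of the frame field; T, E and D are built from Omega and N.
   The 2 in [kappa_g2] and the 1 in [tau_g1] are upper indices. *)
Definition frameT (Omega : R -> R -> E4) : R -> R -> E4 := Du Omega.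

(* Omega_uuu - <Omega_uuu, N> N - <Omega_uuu, T> T *)
Definition preE (Omega N : R -> R -> E4) (u v : R) : E4 :=
  let w := Du (Du (Du Omega)) u v in
  minus (minus w (scal (dot w (N u v)) (N u v)))
        (scal (dot w (frameT Omega u v)) (frameT Omega u v)).

Definition frameE (Omega N : R -> R -> E4) (u v : R) : E4 :=
  normalize (preE Omega N u v).

Definition frameD (Omega N : R -> R -> E4) (u v : R) : E4 :=
  cross (N u v) (frameT Omega u v) (frameE Omega N u v).

Definition kappa_n (Omega N : R -> R -> E4) (u v : R) : R :=
  dot (Du (frameT Omega) u v) (N u v).
Definition kappa_g2 (Omega N : R -> R -> E4) (u v : R) : R :=
  dot (Du (frameE Omega N) u v) (frameD Omega N u v).
Definition tau_g1 (Omega N : R -> R -> E4) (u v : R) : R :=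
  dot (Du (frameE Omega N) u v) (N u v).

(* The derivative formulas
     T_u = kappa_n N,                  E_u = kappa_g2 D + tau_g1 N,
     D_u = - kappa_g2 E,               N_u = - kappa_n T - tau_g1 E
   are consequences of these conditions when kappa_n does not vanish. *)
Record ED2_frame_field (U : R * R -> Prop) (Omega N : R -> R -> E4) : Prop := {
  ED2_unit_speed :
    forall u v, U (u, v) -> enorm (Du Omega u v) = 1;
  ED2_normal :
    forall v, exists (M : E4 -> Prop) (nu : E4 -> E4),
      oriented_hypersurface M nu /\
      forall u, U (u, v) -> M (Omega u v) /\ N u v = nu (Omega u v);
  ED2_dependent :
    forall u v, U (u, v) -> lin_dep3 (N u v) (frameT Omega u v) (Du (Du Omega) u v);
  ED2_nonzero :
    forall u v, U (u, v) -> preE Omega N u v <> zero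
}.

Definition Betchov_Da_Rios (U : R * R -> Prop) (Omega : R -> R -> E4) : Prop :=
  forall u v, U (u, v) ->
    Dv Omega u v =
    cross (Du Omega u v) (Du (Du Omega) u v) (Du (Du (Du Omega)) u v).

Definition g11 (Omega : R -> R -> E4) (u v : R) : R := dot (Du Omega u v) (Du Omega u v).
Definition g12 (Omega : R -> R -> E4) (u v : R) : R := dot (Du Omega u v) (Dv Omega u v).
Definition g22 (Omega : R -> R -> E4) (u v : R) : R := dot (Dv Omega u v) (Dv Omega u v).

Definition WW (Omega N : R -> R -> E4) (u v : R) : R :=
  kappa_n Omega N u v ^ 2 * tau_g1 Omega N u v.

(* The coefficients of the second fundamental form along a normal field X;
   X = E gives the upper index 1 and X = N the upper index 2. *)
Definition c11 (Omega X : R -> R -> E4) (u v : R) : R := dot (Du (Du Omega) u v) (X u v).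
Definition c12 (Omega X : R -> R -> E4) (u v : R) : R := dot (Dv (Du Omega) u v) (X u v).
Definition c22 (Omega X : R -> R -> E4) (u v : R) : R := dot (Dv (Dv Omega) u v) (X u v).

Definition Delta1 (Omega N : R -> R -> E4) (u v : R) : R :=
  let E := frameE Omega N in
  c11 Omega E u v * c12 Omega N u v - c12 Omega E u v * c11 Omega N u v.
Definition Delta2 (Omega N : R -> R -> E4) (u v : R) : R :=
  let E := frameE Omega N in
  c11 Omega E u v * c22 Omega N u v - c22 Omega E u v * c11 Omega N u v.
Definition Delta3 (Omega N : R -> R -> E4) (u v : R) : R :=
  let E := frameE Omega N in
  c12 Omega E u v * c22 Omega N u v - c22 Omega E u v * c12 Omega N u v.

Definition l11 (Omega N : R -> R -> E4) (u v : R) : R :=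
  2 * Delta1 Omega N u v / WW Omega N u v.
Definition l12 (Omega N : R -> R -> E4) (u v : R) : R :=
  Delta2 Omega N u v / WW Omega N u v.
Definition l22 (Omega N : R -> R -> E4) (u v : R) : R :=
  2 * Delta3 Omega N u v / WW Omega N u v.

(* gamma_ij is the coefficient of gamma (Omega_i) on Omega_j, where
   Omega_1 = Omega_u and Omega_2 = Omega_v. *)
Definition gamma_11 (Omega N : R -> R -> E4) (u v : R) : R :=
  (g12 Omega u v * l12 Omega N u v - g22 Omega u v * l11 Omega N u v)
  / WW Omega N u v ^ 2.
Definition gamma_12 (Omega N : R -> R -> E4) (u v : R) : R :=
  (g12 Omega u v * l11 Omega N u v - g11 Omega u v * l12 Omega N u v)
  / WW Omega N u v ^ 2.
Definition gamma_21 (Omega N : R -> R -> E4) (u v : R) : R :=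
  (g12 Omega u v * l22 Omega N u v - g22 Omega u v * l12 Omega N u v)
  / WW Omega N u v ^ 2.
Definition gamma_22 (Omega N : R -> R -> E4) (u v : R) : R :=
  (g12 Omega u v * l12 Omega N u v - g11 Omega u v * l22 Omega N u v)
  / WW Omega N u v ^ 2.

Definition invariant_k (Omega N : R -> R -> E4) (u v : R) : R :=
  gamma_11 Omega N u v * gamma_22 Omega N u v
  - gamma_12 Omega N u v * gamma_21 Omega N u v.
Definition invariant_h (Omega N : R -> R -> E4) (u v : R) : R :=
  - / 2 * (gamma_11 Omega N u v + gamma_22 Omega N u v).

(* Main.v *)
(* By the frame equations the Betchov-Da Rios equation reads Omega_v = W D with
   W = kappa^2 tau, and so Omega_uv = (W D)_u = W_u D - W sigma E.  Comparing
   (T_v)_u with (T_u)_v = (kappa N)_v gives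
     <N_v, D> = (W_uu - W sigma^2) / kappa,
     <N_v, E> = - (2 W_u sigma + W sigma_u) / kappa,
   and comparing (N_v)_u with (N_u)_v along D gives
     tau <D_v, E> = <N_v, D>_u + sigma <N_v, E> + kappa W_u.
   These are all the coefficients of the second fundamental form, hence k and h. *)
Require Import Defs.
From Stdlib Require Import Reals Lra Lia ssreflect.
From Coquelicot Require Import Coquelicot.
Open Scope R_scope.

(** * Calculus of functions of class C^k on an open set *)

(** The frame equations are not hypotheses and have to be derived. The hypersurface supplies [N] of
    unit length and orthogonal to [T]; the linear dependence then forces T_u = kappa N. Hence the
    vector normalized to [E] equals kappa N_u + kappa^2 T, which gives N_u, and D_u follows by
    taking components in an orthonormal frame. The sign in W = kappa^2 tau comes from T x N x E = -
    N x T x E = - D. No derivative in v of [N] or [D] is ever expanded in the frame. Only single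
    components are computed, each by differentiating an inner product that is constant or already
    known in terms of W and sigma; in this way kappa_v and W_v drop out. The price is one more
    derivative in u: <D_v, E> contains <N_v, D>_u and hence W_uuu, the source of the third
    derivatives of kappa and tau in [P]. Relations are kept multiplied by kappa or tau for as long
    as possible, so that division occurs only in the last computation. *)

Lemma open_locally_2d (U : R * R -> Prop) (u v : R) :
  open U -> U (u, v) -> locally_2d (fun s t => U (s, t)) u v.
Proof.
  intros oU Huv. apply locally_2d_locally.
  apply filter_imp with (2 := oU _ Huv). now intros [s t].
Qed.

Lemma open_locally_u (U : R * R -> Prop) (u v : R) :
  open U -> U (u, v) -> locally u (fun s => U (s, v)).
Proof.
  intros oU Huv.
  exact (locally_2d_1d_const_y _ _ _ (open_locally_2d U u v oU Huv)).
Qed.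

Lemma open_locally_v (U : R * R -> Prop) (u v : R) :
  open U -> U (u, v) -> locally v (fun t => U (u, t)).
Proof.
  intros oU Huv.
  exact (locally_2d_1d_const_x _ _ _ (open_locally_2d U u v oU Huv)).
Qed.

(** Frame identities hold only over the domain, while [Derive] is total and takes unconstrained
    values elsewhere. Equality is therefore relative to U, and openness of U makes it stable under
    [du] and [dv]. *)
Definition eq_on {X : Type} (U : R * R -> Prop) (f g : R -> R -> X) : Prop :=
  forall u v, U (u, v) -> f u v = g u v.

Lemma du_ext (U : R * R -> Prop) (f g : R -> R -> R) :
  open U -> eq_on U f g -> eq_on U (du f) (du g).
Proof.
  intros oU fg u v Huv. apply Derive_ext_loc.
  apply filter_imp with (2 := open_locally_u U u v oU Huv).
  intros s Hs. now apply fg.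
Qed.

Lemma dv_ext (U : R * R -> Prop) (f g : R -> R -> R) :
  open U -> eq_on U f g -> eq_on U (dv f) (dv g).
Proof.
  intros oU fg u v Huv. apply Derive_ext_loc.
  apply filter_imp with (2 := open_locally_v U u v oU Huv).
  intros s Hs. now apply fg.
Qed.

(** This allows [du f] to be replaced by an explicit formula valid on U only; openness of U is what
    carries the replacement through the limits defining continuity and derivatives. *)
Lemma class_C_ext (U : R * R -> Prop) (k : nat) (f g : R -> R -> R) :
  open U -> eq_on U f g -> class_C k U f -> class_C k U g.
Proof.
  intros oU. revert f g.
  induction k as [|k IH]; intros f g fg [cf df].
  - split; [|exact I]. intros u v Huv.
    apply continuity_2d_pt_ext_loc with f; [|now apply cf].
    apply locally_2d_impl with (2 := open_locally_2d U u v oU Huv).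
    apply locally_2d_forall. intros. now apply fg.
  - destruct df as (ef & duf & dvf). split; [|split; [|split]].
    + intros u v Huv.
      apply continuity_2d_pt_ext_loc with f; [|now apply cf].
      apply locally_2d_impl with (2 := open_locally_2d U u v oU Huv).
      apply locally_2d_forall. intros. now apply fg.
    + intros u v Huv. destruct (ef u v Huv) as [e1 e2]. split.
      * apply ex_derive_ext_loc with (2 := e1).
        apply filter_imp with (2 := open_locally_u U u v oU Huv).
        intros s Hs. now apply fg.
      * apply ex_derive_ext_loc with (2 := e2).
        apply filter_imp with (2 := open_locally_v U u v oU Huv).
        intros s Hs. now apply fg.
    + apply IH with (2 := duf). now apply du_ext.
    + apply IH with (2 := dvf). now apply dv_ext.
Qed.

Lemma class_C_S (U : R * R -> Prop) (k : nat) (f : R -> R -> R) :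
  class_C (S k) U f -> class_C k U f.
Proof.
  revert f. induction k as [|k IH]; intros f (cf & ef & duf & dvf).
  - split; [exact cf | exact I].
  - split; [exact cf|]. split; [exact ef|]. split; now apply IH.
Qed.

Lemma class_C_le (U : R * R -> Prop) (j k : nat) (f : R -> R -> R) :
  (j <= k)%nat -> class_C k U f -> class_C j U f.
Proof.
  intros jk. induction jk as [|k jk IH]; intros H; [exact H|].
  apply IH. now apply class_C_S.
Qed.

Lemma class_C_du (U : R * R -> Prop) (k : nat) (f : R -> R -> R) :
  class_C (S k) U f -> class_C k U (du f).
Proof. now intros (_ & _ & H & _). Qed.

Lemma class_C_dv (U : R * R -> Prop) (k : nat) (f : R -> R -> R) :
  class_C (S k) U f -> class_C k U (dv f).
Proof. now intros (_ & _ & _ & H). Qed.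

Lemma class_C_ex_du (U : R * R -> Prop) (f : R -> R -> R) (u v : R) :
  class_C 1 U f -> U (u, v) -> ex_derive (fun s => f s v) u.
Proof. intros (_ & ef & _) Huv. exact (proj1 (ef u v Huv)). Qed.

Lemma class_C_ex_dv (U : R * R -> Prop) (f : R -> R -> R) (u v : R) :
  class_C 1 U f -> U (u, v) -> ex_derive (fun t => f u t) v.
Proof. intros (_ & ef & _) Huv. exact (proj2 (ef u v Huv)). Qed.

Lemma class_C_cont (U : R * R -> Prop) (k : nat) (f : R -> R -> R) (u v : R) :
  class_C k U f -> U (u, v) -> continuity_2d_pt f u v.
Proof. destruct k; intros [cf _] Huv; exact (cf u v Huv). Qed.

(** Inductive principle behind the closure lemmas that follow: the partial derivatives are given
    explicitly, so their class can be read off from the induction hypothesis. *)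
Lemma class_C_intro (U : R * R -> Prop) (k : nat) (f fu fv : R -> R -> R) :
  open U ->
  (forall u v, U (u, v) -> continuity_2d_pt f u v) ->
  (forall u v, U (u, v) -> is_derive (fun s => f s v) u (fu u v)) ->
  (forall u v, U (u, v) -> is_derive (fun t => f u t) v (fv u v)) ->
  class_C k U fu -> class_C k U fv -> class_C (S k) U f.
Proof.
  intros oU cf hu hv cu cv. split; [exact cf|]. split; [|split].
  - intros u v Huv. split; eexists; [now apply hu | now apply hv].
  - apply class_C_ext with (3 := cu); [exact oU|].
    intros u v Huv. symmetry. apply is_derive_unique. now apply hu.
  - apply class_C_ext with (3 := cv); [exact oU|].
    intros u v Huv. symmetry. apply is_derive_unique. now apply hv.
Qed.

Lemma class_C_is_du (U : R * R -> Prop) (f : R -> R -> R) (u v : R) :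
  class_C 1 U f -> U (u, v) -> is_derive (fun s => f s v) u (du f u v).
Proof. intros H Huv. apply Derive_correct. now apply (class_C_ex_du U f). Qed.

Lemma class_C_is_dv (U : R * R -> Prop) (f : R -> R -> R) (u v : R) :
  class_C 1 U f -> U (u, v) -> is_derive (fun t => f u t) v (dv f u v).
Proof. intros H Huv. apply Derive_correct. now apply (class_C_ex_dv U f). Qed.

Lemma class_C_plus (U : R * R -> Prop) (k : nat) (f g : R -> R -> R) :
  open U -> class_C k U f -> class_C k U g ->
  class_C k U (fun u v => f u v + g u v).
Proof.
  intros oU. revert f g. induction k as [|k IH]; intros f g Cf Cg.
  - split; [|exact I]. intros u v Huv.
    apply continuity_2d_pt_plus;
        [now apply (class_C_cont U _ f u v Cf) | now apply (class_C_cont U _ g u v Cg)].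
  - assert (C1f : class_C 1 U f) by (apply class_C_le with (2 := Cf); lia).
    assert (C1g : class_C 1 U g) by (apply class_C_le with (2 := Cg); lia).
    apply class_C_intro with (fun u v => du f u v + du g u v)
      (fun u v => dv f u v + dv g u v); [exact oU| | | | |].
    + intros u v Huv. apply continuity_2d_pt_plus;
        [now apply (class_C_cont U _ f u v Cf) | now apply (class_C_cont U _ g u v Cg)].
    + intros u v Huv.
      apply: (is_derive_plus (fun s => f s v) (fun s => g s v));
        now apply class_C_is_du with U.
    + intros u v Huv.
      apply: (is_derive_plus (fun s => f u s) (fun s => g u s));
        now apply class_C_is_dv with U.
    + apply IH; now apply class_C_du.
    + apply IH; now apply class_C_dv.
Qed.

Lemma class_C_mult (U : R * R -> Prop) (k : nat) (f g : R -> R -> R) :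
  open U -> class_C k U f -> class_C k U g ->
  class_C k U (fun u v => f u v * g u v).
Proof.
  intros oU. revert f g. induction k as [|k IH]; intros f g Cf Cg.
  - split; [|exact I]. intros u v Huv.
    apply continuity_2d_pt_mult;
        [now apply (class_C_cont U _ f u v Cf) | now apply (class_C_cont U _ g u v Cg)].
  - assert (C1f : class_C 1 U f) by (apply class_C_le with (2 := Cf); lia).
    assert (C1g : class_C 1 U g) by (apply class_C_le with (2 := Cg); lia).
    apply class_C_intro with (fun u v => du f u v * g u v + f u v * du g u v)
      (fun u v => dv f u v * g u v + f u v * dv g u v); [exact oU| | | | |].
    + intros u v Huv. apply continuity_2d_pt_mult;
        [now apply (class_C_cont U _ f u v Cf) | now apply (class_C_cont U _ g u v Cg)].
    + intros u v Huv.
      apply: (is_derive_mult (fun s => f s v) (fun s => g s v));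
        [now apply class_C_is_du with U | now apply class_C_is_du with U
        | exact Rmult_comm].
    + intros u v Huv.
      apply: (is_derive_mult (fun s => f u s) (fun s => g u s));
        [now apply class_C_is_dv with U | now apply class_C_is_dv with U
        | exact Rmult_comm].
    + apply class_C_plus; [exact oU| |]; apply IH;
        (now apply class_C_du) || (now apply class_C_S).
    + apply class_C_plus; [exact oU| |]; apply IH;
        (now apply class_C_dv) || (now apply class_C_S).
Qed.

Lemma class_C_const (U : R * R -> Prop) (k : nat) (c : R) :
  open U -> class_C k U (fun _ _ => c).
Proof.
  intros oU. revert c. induction k as [|k IH]; intros c.
  - split; [|exact I]. intros. apply continuity_2d_pt_const.
  - apply class_C_intro with (fun _ _ => 0) (fun _ _ => 0); auto.
    + intros. apply continuity_2d_pt_const.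
    + intros. apply: is_derive_const.
    + intros. apply: is_derive_const.
Qed.

Lemma class_C_opp (U : R * R -> Prop) (k : nat) (f : R -> R -> R) :
  open U -> class_C k U f -> class_C k U (fun u v => - f u v).
Proof.
  intros oU Cf. apply class_C_ext with (fun u v => -1 * f u v); [exact oU| |].
  - intros u v _. ring.
  - apply class_C_mult; [exact oU | now apply class_C_const | exact Cf].
Qed.

Lemma class_C_minus (U : R * R -> Prop) (k : nat) (f g : R -> R -> R) :
  open U -> class_C k U f -> class_C k U g ->
  class_C k U (fun u v => f u v - g u v).
Proof.
  intros oU Cf Cg. apply class_C_plus; [exact oU | exact Cf | now apply class_C_opp].
Qed.

(** The induction closes because the partials of 1/f are built from those of f and from 1/f itself,
    needed only one class lower. *)
Lemma class_C_inv (U : R * R -> Prop) (k : nat) (f : R -> R -> R) :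
  open U -> (forall u v, U (u, v) -> f u v <> 0) -> class_C k U f ->
  class_C k U (fun u v => / f u v).
Proof.
  intros oU f0. induction k as [|k IH]; intros Cf.
  - split; [|exact I]. intros u v Huv.
    apply continuity_2d_pt_inv;
        [now apply (class_C_cont U _ f u v Cf) | now apply f0].
  - assert (C1f : class_C 1 U f) by (apply class_C_le with (2 := Cf); lia).
    assert (Cinv : class_C k U (fun u v => / f u v)) by (apply IH, class_C_S, Cf).
    apply class_C_intro with (fun u v => - du f u v * (/ f u v * / f u v))
      (fun u v => - dv f u v * (/ f u v * / f u v)); [exact oU| | | | |].
    + intros u v Huv. apply continuity_2d_pt_inv;
        [now apply (class_C_cont U _ f u v Cf) | now apply f0].
    + intros u v Huv.
      (* The quotient form is the one in [is_derive_inv]; the product form was chosen so that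
         [class_C_mult] applies to the partial derivative. *)
      replace (- du f u v * (/ f u v * / f u v)) with (- du f u v / f u v ^ 2)
        by (field; now apply f0).
      apply: (is_derive_inv (fun s => f s v));
        [now apply class_C_is_du with U | now apply f0].
    + intros u v Huv.
      replace (- dv f u v * (/ f u v * / f u v)) with (- dv f u v / f u v ^ 2)
        by (field; now apply f0).
      apply: (is_derive_inv (fun s => f u s));
        [now apply class_C_is_dv with U | now apply f0].
    + apply class_C_mult; [exact oU| |]; [apply class_C_opp | apply class_C_mult]; auto.
      now apply class_C_du.
    + apply class_C_mult; [exact oU| |]; [apply class_C_opp | apply class_C_mult]; auto.
      now apply class_C_dv.
Qed.

(** Same induction as for the inverse: the derivative of the root is f' / (2 sqrt f), in which the
    root reappears one class lower. Strict positivity is needed since sqrt is not differentiable at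
    0. *)
Lemma class_C_sqrt (U : R * R -> Prop) (k : nat) (f : R -> R -> R) :
  open U -> (forall u v, U (u, v) -> 0 < f u v) -> class_C k U f ->
  class_C k U (fun u v => sqrt (f u v)).
Proof.
  intros oU f0.
  assert (s0 : forall u v, U (u, v) -> 2 * sqrt (f u v) <> 0).
  { intros u v Huv. apply Rgt_not_eq, Rmult_lt_0_compat; [lra|].
    apply sqrt_lt_R0. now apply f0. }
  assert (cs : forall u v, U (u, v) -> continuity_2d_pt f u v ->
            continuity_2d_pt (fun u v => sqrt (f u v)) u v).
  { intros u v Huv cf. apply continuity_1d_2d_pt_comp; [|exact cf].
    apply continuity_pt_sqrt, Rlt_le. now apply f0. }
  induction k as [|k IH]; intros Cf.
  - split; [|exact I]. intros u v Huv. apply cs; [exact Huv | now apply (class_C_cont U _ f u v Cf)].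
  - assert (C1f : class_C 1 U f) by (apply class_C_le with (2 := Cf); lia).
    assert (Cinv : class_C k U (fun u v => / (2 * sqrt (f u v)))).
    { apply class_C_inv; [exact oU | exact s0|].
      apply class_C_mult; [exact oU | now apply class_C_const |].
      apply IH, class_C_S, Cf. }
    apply class_C_intro with (fun u v => du f u v * / (2 * sqrt (f u v)))
      (fun u v => dv f u v * / (2 * sqrt (f u v))); [exact oU| | | | |].
    + intros u v Huv. apply cs; [exact Huv | now apply (class_C_cont U _ f u v Cf)].
    + intros u v Huv. apply: (is_derive_sqrt (fun s => f s v));
        [now apply class_C_is_du with U | now apply f0].
    + intros u v Huv. apply: (is_derive_sqrt (fun s => f u s));
        [now apply class_C_is_dv with U | now apply f0].
    + apply class_C_mult; auto. now apply class_C_du.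
    + apply class_C_mult; auto. now apply class_C_dv.
Qed.

(** [class_C 2] contains the hypotheses of [Schwarz]: the mixed partials exist throughout the open
    set and both are continuous at the point. *)
Lemma du_dv_comm (U : R * R -> Prop) (f : R -> R -> R) (u v : R) :
  open U -> class_C 2 U f -> U (u, v) -> du (dv f) u v = dv (du f) u v.
Proof.
  intros oU (cf & ef & (cfu & efu & _ & (cfuv_c & _)) & (cfv & efv & (cfvu_c & _) & _)) Huv.
  apply (Schwarz f u v).
  - apply locally_2d_impl with (2 := open_locally_2d U u v oU Huv).
    apply locally_2d_forall. intros x y Hxy.
    split; [exact (proj1 (ef x y Hxy))|]. split; [exact (proj2 (ef x y Hxy))|].
    split; [exact (proj1 (efv x y Hxy)) | exact (proj2 (efu x y Hxy))].
  - exact (cfvu_c u v Huv).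
  - exact (cfuv_c u v Huv).
Qed.

Lemma du_mult (U : R * R -> Prop) (f g : R -> R -> R) (u v : R) :
  class_C 1 U f -> class_C 1 U g -> U (u, v) ->
  du (fun u v => f u v * g u v) u v = du f u v * g u v + f u v * du g u v.
Proof.
  intros Cf Cg Huv. apply Derive_mult; now apply class_C_ex_du with U.
Qed.

Lemma du_plus (U : R * R -> Prop) (f g : R -> R -> R) (u v : R) :
  class_C 1 U f -> class_C 1 U g -> U (u, v) ->
  du (fun u v => f u v + g u v) u v = du f u v + du g u v.
Proof.
  intros Cf Cg Huv. apply Derive_plus; now apply class_C_ex_du with U.
Qed.

Lemma dv_mult (U : R * R -> Prop) (f g : R -> R -> R) (u v : R) :
  class_C 1 U f -> class_C 1 U g -> U (u, v) ->
  dv (fun u v => f u v * g u v) u v = dv f u v * g u v + f u v * dv g u v.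
Proof.
  intros Cf Cg Huv. apply (Derive_mult (fun t => f u t) (fun t => g u t));
    now apply class_C_ex_dv with U.
Qed.

Lemma dv_plus (U : R * R -> Prop) (f g : R -> R -> R) (u v : R) :
  class_C 1 U f -> class_C 1 U g -> U (u, v) ->
  dv (fun u v => f u v + g u v) u v = dv f u v + dv g u v.
Proof.
  intros Cf Cg Huv. apply (Derive_plus (fun t => f u t) (fun t => g u t));
    now apply class_C_ex_dv with U.
Qed.

(** * Vector algebra and vector-valued functions *)

Lemma E4_eq (x y : E4) :
  x1 x = x1 y -> x2 x = x2 y -> x3 x = x3 y -> x4 x = x4 y -> x = y.
Proof.
  destruct x as [[[a b] c] d], y as [[[a' b'] c'] d'].
  unfold x1, x2, x3, x4; simpl. now intros -> -> -> ->.
Qed.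

Lemma dot_comm (x y : E4) : dot x y = dot y x.
Proof. unfold dot. ring. Qed.

Lemma dot_plus_l (x y z : E4) : dot (plus x y) z = dot x z + dot y z.
Proof.
  unfold dot, x1, x2, x3, x4. simpl. unfold plus; simpl. ring.
Qed.

Lemma dot_plus_r (x y z : E4) : dot z (plus x y) = dot z x + dot z y.
Proof. now rewrite dot_comm dot_plus_l !(dot_comm z). Qed.

Lemma dot_scal_l (a : R) (x y : E4) : dot (scal a x) y = a * dot x y.
Proof.
  unfold dot, x1, x2, x3, x4. simpl. unfold scal; simpl. unfold mult; simpl. ring.
Qed.

Lemma dot_scal_r (a : R) (x y : E4) : dot y (scal a x) = a * dot y x.
Proof. now rewrite dot_comm dot_scal_l (dot_comm y). Qed.

Lemma dot_opp_l (x y : E4) : dot (opp x) y = - dot x y.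
Proof.
  unfold dot, x1, x2, x3, x4. simpl. unfold opp; simpl. ring.
Qed.

Lemma dot_minus_l (x y z : E4) : dot (minus x y) z = dot x z - dot y z.
Proof. unfold minus. now rewrite dot_plus_l dot_opp_l. Qed.

Lemma dot_zero_l (x : E4) : dot zero x = 0.
Proof. unfold dot, x1, x2, x3, x4. simpl. unfold zero; simpl. ring. Qed.

Lemma dot_self_ge0 (x : E4) : 0 <= dot x x.
Proof. unfold dot. nra. Qed.

Lemma dot_self_eq0 (x : E4) : dot x x = 0 -> x = zero.
Proof. unfold dot. intros H. apply E4_eq; change (?i zero) with 0; nra. Qed.

Lemma dot_self_pos (x : E4) : x <> zero -> 0 < dot x x.
Proof.
  intros x0. destruct (dot_self_ge0 x) as [H|H]; [exact H|].
  now elim x0; apply dot_self_eq0.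
Qed.

Lemma enorm_pos (x : E4) : x <> zero -> 0 < enorm x.
Proof. intros x0. now apply sqrt_lt_R0, dot_self_pos. Qed.

Lemma enorm_sqr (x : E4) : enorm x * enorm x = dot x x.
Proof. apply sqrt_sqrt, dot_self_ge0. Qed.

Lemma dot_normalize (x : E4) : x <> zero -> dot (normalize x) (normalize x) = 1.
Proof.
  intros x0. unfold normalize.
  rewrite dot_scal_l dot_scal_r -enorm_sqr. field.
  now apply Rgt_not_eq, enorm_pos.
Qed.

Lemma scal_enorm_normalize (x : E4) : x <> zero -> scal (enorm x) (normalize x) = x.
Proof.
  intros x0. unfold normalize. rewrite scal_assoc.
  unfold mult; simpl. rewrite Rinv_r; [|now apply Rgt_not_eq, enorm_pos].
  exact (scal_one x).
Qed.

Lemma dot_cross (w x y z : E4) : dot w (cross x y z) = det4 w x y z.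
Proof.
  unfold dot, cross, det4, e1, e2, e3, e4, x1, x2, x3, x4; simpl. ring.
Qed.

(** The identity det(A)^2 = det(A A^T), with the Gram determinant expanded along the row of w. *)
Lemma gram4 (w x y z : E4) :
  det4 w x y z * det4 w x y z =
    dot w w * (dot x x * (dot y y * dot z z - dot y z * dot y z)
             - dot x y * (dot x y * dot z z - dot y z * dot x z)
             + dot x z * (dot x y * dot y z - dot y y * dot x z))
  - dot w x * (dot w x * (dot y y * dot z z - dot y z * dot y z)
             - dot x y * (dot w y * dot z z - dot y z * dot w z)
             + dot x z * (dot w y * dot y z - dot y y * dot w z))
  + dot w y * (dot w x * (dot x y * dot z z - dot y z * dot x z)
             - dot x x * (dot w y * dot z z - dot y z * dot w z)
             + dot x z * (dot w y * dot x z - dot x y * dot w z))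
  - dot w z * (dot w x * (dot x y * dot y z - dot y y * dot x z)
             - dot x x * (dot w y * dot y z - dot y y * dot w z)
             + dot x y * (dot w y * dot x z - dot x y * dot w z)).
Proof.
  destruct w as [[[w1 w2] w3] w4], x as [[[a1 a2] a3] a4],
    y as [[[b1 b2] b3] b4], z as [[[c1 c2] c3] c4].
  unfold det4, det3, dot, x1, x2, x3, x4; simpl. ring.
Qed.

(** The length of the ternary product is a 3 x 3 Gram determinant, by the Cauchy-Binet formula. *)
Lemma gram3 (x y z : E4) :
  dot (cross x y z) (cross x y z) =
    dot x x * (dot y y * dot z z - dot y z * dot y z)
  - dot x y * (dot x y * dot z z - dot y z * dot x z)
  + dot x z * (dot x y * dot y z - dot y y * dot x z).
Proof.
  destruct x as [[[a1 a2] a3] a4], y as [[[b1 b2] b3] b4], z as [[[c1 c2] c3] c4].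
  unfold cross, det4, det3, dot, e1, e2, e3, e4, x1, x2, x3, x4; simpl. ring.
Qed.

Lemma cross_dot_1 (x y z : E4) : dot (cross x y z) x = 0.
Proof. rewrite dot_comm dot_cross. unfold det4, det3. ring. Qed.

Lemma cross_dot_2 (x y z : E4) : dot (cross x y z) y = 0.
Proof. rewrite dot_comm dot_cross. unfold det4, det3. ring. Qed.

Lemma cross_dot_3 (x y z : E4) : dot (cross x y z) z = 0.
Proof. rewrite dot_comm dot_cross. unfold det4, det3. ring. Qed.

Lemma cross_orthonormal (x y z : E4) :
  dot x x = 1 -> dot y y = 1 -> dot z z = 1 ->
  dot x y = 0 -> dot x z = 0 -> dot y z = 0 ->
  dot (cross x y z) (cross x y z) = 1.
Proof. intros xx yy zz xy xz yz. rewrite gram3 xx yy zz xy xz yz. ring. Qed.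

(* The Gram determinant of w, x, y, z is det4 w x y z ^ 2 = 0 and, by
   orthonormality, equals dot w w. *)
Lemma orthonormal_zero (w x y z : E4) :
  dot x x = 1 -> dot y y = 1 -> dot z z = 1 ->
  dot x y = 0 -> dot x z = 0 -> dot y z = 0 ->
  dot w x = 0 -> dot w y = 0 -> dot w z = 0 -> dot w (cross x y z) = 0 ->
  w = zero.
Proof.
  intros xx yy zz xy xz yz wx wy wz wc.
  assert (H := gram4 w x y z).
  rewrite -dot_cross wc wx wy wz xx yy zz xy xz yz in H.
  apply dot_self_eq0. lra.
Qed.

(** * Smoothness of vector-valued functions *)

Lemma class_C_E4_le (U : R * R -> Prop) (j k : nat) (X : R -> R -> E4) :
  (j <= k)%nat -> class_C_E4 k U X -> class_C_E4 j U X.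
Proof.
  intros jk (C1 & C2 & C3 & C4).
  exact (conj (class_C_le _ _ _ _ jk C1) (conj (class_C_le _ _ _ _ jk C2)
        (conj (class_C_le _ _ _ _ jk C3) (class_C_le _ _ _ _ jk C4)))).
Qed.

Lemma class_C_E4_Du (U : R * R -> Prop) (k : nat) (X : R -> R -> E4) :
  class_C_E4 (S k) U X -> class_C_E4 k U (Du X).
Proof.
  intros (C1 & C2 & C3 & C4).
  exact (conj (class_C_du _ _ _ C1) (conj (class_C_du _ _ _ C2)
        (conj (class_C_du _ _ _ C3) (class_C_du _ _ _ C4)))).
Qed.

Lemma class_C_E4_Dv (U : R * R -> Prop) (k : nat) (X : R -> R -> E4) :
  class_C_E4 (S k) U X -> class_C_E4 k U (Dv X).
Proof.
  intros (C1 & C2 & C3 & C4).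
  exact (conj (class_C_dv _ _ _ C1) (conj (class_C_dv _ _ _ C2)
        (conj (class_C_dv _ _ _ C3) (class_C_dv _ _ _ C4)))).
Qed.

Lemma class_C_dot (U : R * R -> Prop) (k : nat) (X Y : R -> R -> E4) :
  open U -> class_C_E4 k U X -> class_C_E4 k U Y ->
  class_C k U (fun u v => dot (X u v) (Y u v)).
Proof.
  intros oU (C1 & C2 & C3 & C4) (D1 & D2 & D3 & D4).
  exact (class_C_plus _ _ _ _ oU (class_C_plus _ _ _ _ oU (class_C_plus _ _ _ _ oU
    (class_C_mult _ _ _ _ oU C1 D1) (class_C_mult _ _ _ _ oU C2 D2))
    (class_C_mult _ _ _ _ oU C3 D3)) (class_C_mult _ _ _ _ oU C4 D4)).
Qed.

Lemma class_C_E4_scal (U : R * R -> Prop) (k : nat) (f : R -> R -> R)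
    (X : R -> R -> E4) :
  open U -> class_C k U f -> class_C_E4 k U X ->
  class_C_E4 k U (fun u v => scal (f u v) (X u v)).
Proof.
  intros oU Cf (C1 & C2 & C3 & C4).
  exact (conj (class_C_mult _ _ _ _ oU Cf C1) (conj (class_C_mult _ _ _ _ oU Cf C2)
        (conj (class_C_mult _ _ _ _ oU Cf C3) (class_C_mult _ _ _ _ oU Cf C4)))).
Qed.

Lemma class_C_E4_minus (U : R * R -> Prop) (k : nat) (X Y : R -> R -> E4) :
  open U -> class_C_E4 k U X -> class_C_E4 k U Y ->
  class_C_E4 k U (fun u v => minus (X u v) (Y u v)).
Proof.
  intros oU (C1 & C2 & C3 & C4) (D1 & D2 & D3 & D4).
  exact (conj (class_C_minus _ _ _ _ oU C1 D1) (conj (class_C_minus _ _ _ _ oU C2 D2)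
        (conj (class_C_minus _ _ _ _ oU C3 D3) (class_C_minus _ _ _ _ oU C4 D4)))).
Qed.

Lemma class_C_E4_cross (U : R * R -> Prop) (k : nat) (X Y Z : R -> R -> E4) :
  open U -> class_C_E4 k U X -> class_C_E4 k U Y -> class_C_E4 k U Z ->
  class_C_E4 k U (fun u v => cross (X u v) (Y u v) (Z u v)).
Proof.
  intros oU (A1 & A2 & A3 & A4) (B1 & B2 & B3 & B4) (C1 & C2 & C3 & C4).
  refine (conj _ (conj _ (conj _ _)));
    unfold coord, cross, det4, det3, x1, x2, x3, x4; simpl;
    repeat (apply class_C_minus || apply class_C_plus || apply class_C_mult
            || apply class_C_const || exact oU || assumption).
Qed.

Lemma class_C_E4_normalize (U : R * R -> Prop) (k : nat) (X : R -> R -> E4) :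
  open U -> (forall u v, U (u, v) -> X u v <> zero) -> class_C_E4 k U X ->
  class_C_E4 k U (fun u v => normalize (X u v)).
Proof.
  intros oU X0 CX. apply class_C_E4_scal; [exact oU| |exact CX].
  apply class_C_inv; [exact oU| |].
  - intros u v Huv. now apply Rgt_not_eq, enorm_pos, X0.
  - apply class_C_sqrt; [exact oU| |now apply class_C_dot].
    intros u v Huv. now apply dot_self_pos, X0.
Qed.

(** * Differentiation rules for vector-valued functions *)

Lemma Du_ext (U : R * R -> Prop) (X Y : R -> R -> E4) :
  open U -> eq_on U X Y -> eq_on U (Du X) (Du Y).
Proof.
  intros oU XY u v Huv. unfold Du.
  now rewrite !(fun i : E4 -> R => du_ext U (coord i X) (coord i Y) oU
    (fun u v H => f_equal i (XY u v H)) u v Huv).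
Qed.

Lemma Dv_ext (U : R * R -> Prop) (X Y : R -> R -> E4) :
  open U -> eq_on U X Y -> eq_on U (Dv X) (Dv Y).
Proof.
  intros oU XY u v Huv. unfold Dv.
  now rewrite !(fun i : E4 -> R => dv_ext U (coord i X) (coord i Y) oU
    (fun u v H => f_equal i (XY u v H)) u v Huv).
Qed.

Lemma du_dot (U : R * R -> Prop) (X Y : R -> R -> E4) (u v : R) :
  open U -> class_C_E4 1 U X -> class_C_E4 1 U Y -> U (u, v) ->
  du (fun u v => dot (X u v) (Y u v)) u v =
  dot (Du X u v) (Y u v) + dot (X u v) (Du Y u v).
Proof.
  intros oU (C1 & C2 & C3 & C4) (D1 & D2 & D3 & D4) Huv.
  assert (M1 := class_C_mult _ _ _ _ oU C1 D1).
  assert (M2 := class_C_mult _ _ _ _ oU C2 D2).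
  assert (M3 := class_C_mult _ _ _ _ oU C3 D3).
  assert (M4 := class_C_mult _ _ _ _ oU C4 D4).
  assert (P2 := class_C_plus _ _ _ _ oU M1 M2).
  assert (P3 := class_C_plus _ _ _ _ oU P2 M3).
  etransitivity; [exact (du_plus U _ _ u v P3 M4 Huv)|].
  rewrite (du_plus U _ _ u v P2 M3 Huv) (du_plus U _ _ u v M1 M2 Huv).
  rewrite (du_mult U _ _ u v C1 D1 Huv) (du_mult U _ _ u v C2 D2 Huv)
    (du_mult U _ _ u v C3 D3 Huv) (du_mult U _ _ u v C4 D4 Huv).
  unfold dot, Du, coord, x1, x2, x3, x4; simpl. ring.
Qed.

Lemma dv_dot (U : R * R -> Prop) (X Y : R -> R -> E4) (u v : R) :
  open U -> class_C_E4 1 U X -> class_C_E4 1 U Y -> U (u, v) ->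
  dv (fun u v => dot (X u v) (Y u v)) u v =
  dot (Dv X u v) (Y u v) + dot (X u v) (Dv Y u v).
Proof.
  intros oU (C1 & C2 & C3 & C4) (D1 & D2 & D3 & D4) Huv.
  assert (M1 := class_C_mult _ _ _ _ oU C1 D1).
  assert (M2 := class_C_mult _ _ _ _ oU C2 D2).
  assert (M3 := class_C_mult _ _ _ _ oU C3 D3).
  assert (M4 := class_C_mult _ _ _ _ oU C4 D4).
  assert (P2 := class_C_plus _ _ _ _ oU M1 M2).
  assert (P3 := class_C_plus _ _ _ _ oU P2 M3).
  etransitivity; [exact (dv_plus U _ _ u v P3 M4 Huv)|].
  rewrite (dv_plus U _ _ u v P2 M3 Huv) (dv_plus U _ _ u v M1 M2 Huv).
  rewrite (dv_mult U _ _ u v C1 D1 Huv) (dv_mult U _ _ u v C2 D2 Huv)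
    (dv_mult U _ _ u v C3 D3 Huv) (dv_mult U _ _ u v C4 D4 Huv).
  unfold dot, Dv, coord, x1, x2, x3, x4; simpl. ring.
Qed.

Lemma Du_scal (U : R * R -> Prop) (f : R -> R -> R) (X : R -> R -> E4) (u v : R) :
  class_C 1 U f -> class_C_E4 1 U X -> U (u, v) ->
  Du (fun u v => scal (f u v) (X u v)) u v =
  plus (scal (du f u v) (X u v)) (scal (f u v) (Du X u v)).
Proof.
  intros Cf (C1 & C2 & C3 & C4) Huv. apply E4_eq.
  - exact (du_mult U f (coord x1 X) u v Cf C1 Huv).
  - exact (du_mult U f (coord x2 X) u v Cf C2 Huv).
  - exact (du_mult U f (coord x3 X) u v Cf C3 Huv).
  - exact (du_mult U f (coord x4 X) u v Cf C4 Huv).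
Qed.

Lemma Dv_scal (U : R * R -> Prop) (f : R -> R -> R) (X : R -> R -> E4) (u v : R) :
  class_C 1 U f -> class_C_E4 1 U X -> U (u, v) ->
  Dv (fun u v => scal (f u v) (X u v)) u v =
  plus (scal (dv f u v) (X u v)) (scal (f u v) (Dv X u v)).
Proof.
  intros Cf (C1 & C2 & C3 & C4) Huv. apply E4_eq.
  - exact (dv_mult U f (coord x1 X) u v Cf C1 Huv).
  - exact (dv_mult U f (coord x2 X) u v Cf C2 Huv).
  - exact (dv_mult U f (coord x3 X) u v Cf C3 Huv).
  - exact (dv_mult U f (coord x4 X) u v Cf C4 Huv).
Qed.

Lemma Du_Dv_comm (U : R * R -> Prop) (X : R -> R -> E4) (u v : R) :
  open U -> class_C_E4 2 U X -> U (u, v) -> Du (Dv X) u v = Dv (Du X) u v.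
Proof.
  intros oU (C1 & C2 & C3 & C4) Huv. apply E4_eq.
  - exact (du_dv_comm U (coord x1 X) u v oU C1 Huv).
  - exact (du_dv_comm U (coord x2 X) u v oU C2 Huv).
  - exact (du_dv_comm U (coord x3 X) u v oU C3 Huv).
  - exact (du_dv_comm U (coord x4 X) u v oU C4 Huv).
Qed.

(** * Normals of hypersurfaces *)

(** [E4] is an iterated product, so applying this three times assembles the differential of a curve
    from those of its coordinates. *)
Lemma filterdiff_pair {V W Z : NormedModule R_AbsRing} (f : V -> W) (g : V -> Z)
    (lf : V -> W) (lg : V -> Z) (x : V) :
  filterdiff f (locally x) lf -> filterdiff g (locally x) lg ->
  filterdiff (fun y => (f y, g y)) (locally x) (fun y => (lf y, lg y)).
Proof.
  intros Hf Hg.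
  (* What remains is that pairing is its own differential; it is the identity of the product up to
     eta for pairs. *)
  apply (filterdiff_comp'_2 f g (fun a b => (a, b)) x lf lg (fun a b => (a, b)) Hf Hg).
  apply filterdiff_ext with (fun t : prod_NormedModule R_AbsRing W Z => t);
    [now intros []|].
  apply filterdiff_ext_lin with (fun t : prod_NormedModule R_AbsRing W Z => t);
    [apply filterdiff_id | now intros []].
Qed.

Lemma hypersurface_normal_unit (M : E4 -> Prop) (nu : E4 -> E4) (p : E4) :
  oriented_hypersurface M nu -> M p -> dot (nu p) (nu p) = 1.
Proof.
  intros HM Mp. destruct (HM p Mp) as (V & F & G & oV & Vp & HV).
  destruct (HV p Vp) as (_ & _ & G0 & _ & Hnu). rewrite (Hnu Mp).
  now apply dot_normalize.
Qed.

(** A defining function F vanishes along a curve in M, so by the chain rule its gradient is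
    orthogonal to the velocity, and the normal is a multiple of the gradient. The curve is given by
    four scalar functions because [Du] is defined coordinatewise. *)
Lemma hypersurface_normal_orthogonal (M : E4 -> Prop) (nu : E4 -> E4)
    (a b c d : R -> R) (a' b' c' d' s : R) :
  oriented_hypersurface M nu ->
  locally s (fun r => M (a r, b r, c r, d r)) ->
  is_derive a s a' -> is_derive b s b' -> is_derive c s c' -> is_derive d s d' ->
  dot (nu (a s, b s, c s, d s)) (a', b', c', d') = 0.
Proof.
  intros HM Mc Ha Hb Hc Hd.
  set (p := (a s, b s, c s, d s) : E4).
  assert (Mp : M p) by exact (locally_singleton _ _ Mc).
  destruct (HM p Mp) as (V & F & G & oV & Vp & HV).
  destruct (HV p Vp) as (HF & _ & G0 & _ & Hnu). rewrite (Hnu Mp).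
  assert (Hg : filterdiff (fun r => (a r, b r, c r, d r)) (locally s)
    (fun r : R => (scal r a', scal r b', scal r c', scal r d'))).
  { exact (filterdiff_pair _ _ _ _ s (filterdiff_pair _ _ _ _ s
      (filterdiff_pair _ _ _ _ s Ha Hb) Hc) Hd). }
  (* The normed module structure on [E4] is spelled out so that the differential of the curve can be
     composed with that of F. *)
  set (E := prod_NormedModule R_AbsRing (prod_NormedModule R_AbsRing
    (prod_NormedModule R_AbsRing R_NormedModule R_NormedModule) R_NormedModule)
    R_NormedModule).
  assert (cg := filterdiff_continuous (V := E) _ s (ex_intro _ _ Hg)).
  (* Continuity keeps the curve in V near s, where membership in M means F = 0. *)
  assert (F0 : locally s (fun r => F (a r, b r, c r, d r) = 0)).
  { assert (Vr := cg _ (oV p Vp)). unfold filtermap in Vr.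
    apply filter_imp with (2 := filter_and _ _ Mc Vr).
    intros r [Mr Hr]. now apply (HV _ Hr). }
  assert (D := filterdiff_comp' (V := E) _ F s _ _ Hg HF).
  (* The composite differential sends r to r times <G p, velocity>, so this inner product is the
     derivative of F along the curve; [D0] shows that the same derivative is 0. *)
  assert (D' : is_derive (fun r => F (a r, b r, c r, d r)) s
                 (dot (G p) (a', b', c', d'))).
  { apply (filterdiff_ext_lin _ _ _ D). intros r.
    exact (dot_scal_r r (a', b', c', d') (G p)). }
  assert (D0 : is_derive (fun r => F (a r, b r, c r, d r)) s 0).
  { apply is_derive_ext_loc with (fun _ => 0);
      [|apply: is_derive_const].
    apply filter_imp with (2 := F0). now intros r ->. }
  unfold normalize. rewrite dot_scal_l.
  rewrite -(is_derive_unique _ _ _ D') (is_derive_unique _ _ _ D0). ring.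
Qed.

(** * Derivatives of constant inner products and of kappa^2 tau *)

Lemma du_dot_const (U : R * R -> Prop) (X Y : R -> R -> E4) (c u v : R) :
  open U -> class_C_E4 1 U X -> class_C_E4 1 U Y ->
  (forall u v, U (u, v) -> dot (X u v) (Y u v) = c) -> U (u, v) ->
  dot (Du X u v) (Y u v) = - dot (X u v) (Du Y u v).
Proof.
  intros oU CX CY XY Huv.
  assert (H := du_dot U X Y u v oU CX CY Huv).
  rewrite (du_ext U _ (fun _ _ => c) oU XY u v Huv) in H.
  assert (H0 : du (fun _ _ => c) u v = 0) by exact (Derive_const c u). lra.
Qed.

Lemma dv_dot_const (U : R * R -> Prop) (X Y : R -> R -> E4) (c u v : R) :
  open U -> class_C_E4 1 U X -> class_C_E4 1 U Y ->
  (forall u v, U (u, v) -> dot (X u v) (Y u v) = c) -> U (u, v) ->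
  dot (Dv X u v) (Y u v) = - dot (X u v) (Dv Y u v).
Proof.
  intros oU CX CY XY Huv.
  assert (H := dv_dot U X Y u v oU CX CY Huv).
  rewrite (dv_ext U _ (fun _ _ => c) oU XY u v Huv) in H.
  assert (H0 : dv (fun _ _ => c) u v = 0) by exact (Derive_const c v). lra.
Qed.

(** This and the two lemmas after it are applied to kappa and tau: [WW] is convertible to kappa^2
    tau, and its u-derivatives up to order three enter the invariants. *)
Lemma du_square_mult (U : R * R -> Prop) (k t : R -> R -> R) :
  open U -> class_C 1 U k -> class_C 1 U t ->
  eq_on U (du (fun u v => k u v ^ 2 * t u v))
    (fun u v => 2 * k u v * du k u v * t u v + k u v ^ 2 * du t u v).
Proof.
  intros oU Ck Ct u v Huv.
  assert (ek := class_C_ex_du U k u v Ck Huv).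
  assert (et := class_C_ex_du U t u v Ct Huv).
  apply is_derive_unique. auto_derive; [tauto|]. unfold du. ring.
Qed.

Lemma du2_square_mult (U : R * R -> Prop) (k t : R -> R -> R) :
  open U -> class_C 2 U k -> class_C 2 U t ->
  eq_on U (du (du (fun u v => k u v ^ 2 * t u v)))
    (fun u v => 2 * du k u v ^ 2 * t u v + 2 * k u v * du (du k) u v * t u v
      + 4 * k u v * du k u v * du t u v + k u v ^ 2 * du (du t) u v).
Proof.
  intros oU Ck Ct u v Huv.
  assert (Ck1 := class_C_S U 1 k Ck). assert (Ct1 := class_C_S U 1 t Ct).
  rewrite (du_ext U _ _ oU (du_square_mult U k t oU Ck1 Ct1) u v Huv).
  assert (ek := class_C_ex_du U k u v Ck1 Huv).
  assert (et := class_C_ex_du U t u v Ct1 Huv).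
  assert (eku := class_C_ex_du U (du k) u v (class_C_du U 1 k Ck) Huv).
  assert (etu := class_C_ex_du U (du t) u v (class_C_du U 1 t Ct) Huv).
  apply is_derive_unique. auto_derive; [tauto|]. unfold du. ring.
Qed.

Lemma du3_square_mult (U : R * R -> Prop) (k t : R -> R -> R) :
  open U -> class_C 3 U k -> class_C 3 U t ->
  eq_on U (du (du (du (fun u v => k u v ^ 2 * t u v))))
    (fun u v => 6 * du k u v * du (du k) u v * t u v
      + 2 * k u v * du (du (du k)) u v * t u v
      + 6 * du k u v ^ 2 * du t u v + 6 * k u v * du (du k) u v * du t u v
      + 6 * k u v * du k u v * du (du t) u v + k u v ^ 2 * du (du (du t)) u v).
Proof.
  intros oU Ck Ct u v Huv.
  assert (Ck2 := class_C_S U 2 k Ck). assert (Ct2 := class_C_S U 2 t Ct).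
  rewrite (du_ext U _ _ oU (du2_square_mult U k t oU Ck2 Ct2) u v Huv).
  assert (ek := class_C_ex_du U k u v (class_C_S U 1 k Ck2) Huv).
  assert (et := class_C_ex_du U t u v (class_C_S U 1 t Ct2) Huv).
  assert (eku := class_C_ex_du U (du k) u v (class_C_du U 1 k Ck2) Huv).
  assert (etu := class_C_ex_du U (du t) u v (class_C_du U 1 t Ct2) Huv).
  assert (ekuu := class_C_ex_du U (du (du k)) u v
    (class_C_du U 1 _ (class_C_du U 2 k Ck)) Huv).
  assert (etuu := class_C_ex_du U (du (du t)) u v
    (class_C_du U 1 _ (class_C_du U 2 t Ct)) Huv).
  apply is_derive_unique. auto_derive; [tauto|]. unfold du. ring.
Qed.

(** * The frame equations and the second fundamental form *)

Section Frame.

Variables (U : R * R -> Prop) (Omega N : R -> R -> E4).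
Hypothesis (oU : open U).
Hypothesis (C_Omega : class_C_E4 7 U Omega).
Hypothesis (C_N : class_C_E4 5 U N).
Hypothesis (frame : ED2_frame_field U Omega N).
Hypothesis (kappa_neq0 : forall u v, U (u, v) -> kappa_n Omega N u v <> 0).

Notation T := (frameT Omega).
Notation E := (frameE Omega N).
Notation D := (frameD Omega N).
Notation kappa := (kappa_n Omega N).
Notation sigma := (kappa_g2 Omega N).
Notation tau := (tau_g1 Omega N).
Notation W := (WW Omega N).

(** * Regularity of the frame and of its associated functions *)

Lemma C_T : class_C_E4 6 U T.
Proof. exact (class_C_E4_Du _ _ _ C_Omega). Qed.

Lemma C_preE : class_C_E4 4 U (preE Omega N).
Proof.
  assert (C3 : class_C_E4 4 U (Du (Du (Du Omega))))
    by exact (class_C_E4_Du _ _ _ (class_C_E4_Du _ _ _ C_T)).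
  assert (CN : class_C_E4 4 U N) by (apply class_C_E4_le with (2 := C_N); lia).
  assert (CT : class_C_E4 4 U T) by (apply class_C_E4_le with (2 := C_T); lia).
  exact (class_C_E4_minus _ _ _ _ oU
    (class_C_E4_minus _ _ _ _ oU C3
      (class_C_E4_scal _ _ _ _ oU (class_C_dot _ _ _ _ oU C3 CN) CN))
    (class_C_E4_scal _ _ _ _ oU (class_C_dot _ _ _ _ oU C3 CT) CT)).
Qed.

Lemma C_E : class_C_E4 4 U E.
Proof.
  exact (class_C_E4_normalize _ _ _ oU (ED2_nonzero _ _ _ frame) C_preE).
Qed.

Lemma C_D : class_C_E4 4 U D.
Proof.
  apply class_C_E4_cross; [exact oU| | |exact C_E].
  - apply class_C_E4_le with (2 := C_N); lia.
  - apply class_C_E4_le with (2 := C_T); lia.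
Qed.

Lemma C_kappa : class_C 5 U kappa.
Proof. exact (class_C_dot _ _ _ _ oU (class_C_E4_Du _ _ _ C_T) C_N). Qed.

Lemma C_sigma : class_C 3 U sigma.
Proof.
  apply (class_C_dot _ _ _ _ oU (class_C_E4_Du _ _ _ C_E)).
  apply class_C_E4_le with (2 := C_D); lia.
Qed.

Lemma C_tau : class_C 3 U tau.
Proof.
  apply (class_C_dot _ _ _ _ oU (class_C_E4_Du _ _ _ C_E)).
  apply class_C_E4_le with (2 := C_N); lia.
Qed.

Lemma C1_T : class_C_E4 1 U T.
Proof. apply class_C_E4_le with (2 := C_T); lia. Qed.

Lemma C1_E : class_C_E4 1 U E.
Proof. apply class_C_E4_le with (2 := C_E); lia. Qed.

Lemma C1_D : class_C_E4 1 U D.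
Proof. apply class_C_E4_le with (2 := C_D); lia. Qed.

Lemma C1_N : class_C_E4 1 U N.
Proof. apply class_C_E4_le with (2 := C_N); lia. Qed.

(** * Orthonormality and the frame equations *)

Lemma dot_TT (u v : R) : U (u, v) -> dot (T u v) (T u v) = 1.
Proof.
  intros Huv. rewrite -enorm_sqr (ED2_unit_speed _ _ _ frame u v Huv). ring.
Qed.

Lemma dot_NN (u v : R) : U (u, v) -> dot (N u v) (N u v) = 1.
Proof.
  intros Huv. destruct (ED2_normal _ _ _ frame v) as (M & nu & HM & HN).
  destruct (HN u Huv) as [Mp ->].
  now apply hypersurface_normal_unit with M.
Qed.

Lemma dot_NT (u v : R) : U (u, v) -> dot (N u v) (T u v) = 0.
Proof.
  intros Huv. destruct (ED2_normal _ _ _ frame v) as (M & nu & HM & HN).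
  destruct (HN u Huv) as [Mp ->].
  assert (C1 : class_C_E4 1 U Omega) by (apply class_C_E4_le with (2 := C_Omega); lia).
  destruct C1 as (C1 & C2 & C3 & C4).
  (* The point is rewritten as the tuple of its coordinates to match the four scalar functions of
     the orthogonality lemma. *)
  assert (eta : forall p : E4, (x1 p, x2 p, x3 p, x4 p) = p)
    by now intros [[[? ?] ?] ?].
  rewrite -(eta (Omega u v)).
  apply (hypersurface_normal_orthogonal M nu (fun s => coord x1 Omega s v)
    (fun s => coord x2 Omega s v) (fun s => coord x3 Omega s v)
    (fun s => coord x4 Omega s v)); [exact HM| | | | |];
    try now apply class_C_is_du with U.
  apply filter_imp with (2 := open_locally_u U u v oU Huv).
  intros s Hs. unfold coord. rewrite eta. now apply HN.
Qed.

Lemma dot_TuT (u v : R) : U (u, v) -> dot (Du T u v) (T u v) = 0.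
Proof.
  intros Huv.
  assert (H := du_dot_const U T T 1 u v oU C1_T C1_T dot_TT Huv).
  rewrite (dot_comm (T u v)) in H. lra.
Qed.

(** In a relation a N + b T + c T_u = 0, the product with T gives b = 0 and the product with N gives
    a = - c kappa. If c were 0, all coefficients would vanish; so the relation reads c (T_u - kappa
    N) = 0 with c nonzero. *)
Lemma Tu_eq (u v : R) : U (u, v) -> Du T u v = scal (kappa u v) (N u v).
Proof.
  intros Huv.
  destruct (ED2_dependent _ _ _ frame u v Huv) as (a & b & c & abc & H).
  change (Du (Du Omega)) with (Du T) in H.
  assert (HT : b = 0).
  { assert (H1 := f_equal (fun X => dot X (T u v)) H).
    rewrite !dot_plus_l !dot_scal_l dot_zero_l dot_NT // dot_TT // dot_TuT // in H1.
    lra. }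
  assert (HN : a + c * kappa u v = 0).
  { assert (H1 := f_equal (fun X => dot X (N u v)) H).
    rewrite !dot_plus_l !dot_scal_l dot_zero_l dot_NN // HT in H1.
    unfold kappa_n. lra. }
  assert (c0 : c <> 0).
  { intros c0. rewrite c0 in HN. destruct abc as [h|[h|h]]; apply h; lra. }
  assert (Hx : forall e, c * (dot (Du T u v) e - dot (scal (kappa u v) (N u v)) e) = 0).
  { intros e. assert (H1 := f_equal (fun X => dot X e) H).
    rewrite !dot_plus_l !dot_scal_l dot_zero_l HT in H1.
    rewrite dot_scal_l. replace a with (- c * kappa u v) in H1 by lra. lra. }
  (* With e taken to be the difference itself, [Hx] says that its squared length is 0. *)
  assert (Hz : minus (Du T u v) (scal (kappa u v) (N u v)) = zero).
  { apply dot_self_eq0. rewrite dot_minus_l.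
    apply Rmult_eq_reg_l with (2 := c0). now rewrite Hx Rmult_0_r. }
  apply plus_reg_r with (opp (scal (kappa u v) (N u v))).
  now rewrite plus_opp_r.
Qed.

Lemma dot_NuN (u v : R) : U (u, v) -> dot (Du N u v) (N u v) = 0.
Proof.
  intros Huv.
  assert (H := du_dot_const U N N 1 u v oU C1_N C1_N dot_NN Huv).
  rewrite (dot_comm (N u v)) in H. lra.
Qed.

Lemma dot_NuT (u v : R) : U (u, v) -> dot (Du N u v) (T u v) = - kappa u v.
Proof.
  intros Huv. rewrite (du_dot_const U N T 0 u v oU C1_N C1_T dot_NT Huv).
  now rewrite dot_comm.
Qed.

Lemma Omega_uuu_eq (u v : R) : U (u, v) ->
  Du (Du (Du Omega)) u v =
  plus (scal (du kappa u v) (N u v)) (scal (kappa u v) (Du N u v)).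
Proof.
  intros Huv. change (Du (Du (Du Omega))) with (Du (Du T)).
  rewrite (Du_ext U _ (fun u v => scal (kappa u v) (N u v)) oU Tu_eq u v Huv).
  apply (Du_scal U); [|exact C1_N|exact Huv].
  apply class_C_le with (2 := C_kappa); lia.
Qed.

(** Projecting out N removes kappa_u N; the T component of kappa N_u is - kappa^2, so projecting it
    out adds kappa^2 T. This is the link between [E] and N_u. *)
Lemma preE_eq (u v : R) : U (u, v) ->
  preE Omega N u v =
  plus (scal (kappa u v) (Du N u v)) (scal (kappa u v ^ 2) (T u v)).
Proof.
  intros Huv. unfold preE. rewrite Omega_uuu_eq //.
  rewrite !dot_plus_l !dot_scal_l dot_NN // dot_NT // dot_NuN // dot_NuT //.
  apply E4_eq; unfold x1, x2, x3, x4; simpl; unfold minus, plus, opp, scal; simpl;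
    unfold mult; simpl; ring.
Qed.

Lemma preE_E (u v : R) : U (u, v) ->
  scal (enorm (preE Omega N u v)) (E u v) = preE Omega N u v.
Proof. intros Huv. now apply scal_enorm_normalize, (ED2_nonzero _ _ _ frame). Qed.

Lemma dot_EE (u v : R) : U (u, v) -> dot (E u v) (E u v) = 1.
Proof. intros Huv. now apply dot_normalize, (ED2_nonzero _ _ _ frame). Qed.

Lemma dot_NE (u v : R) : U (u, v) -> dot (N u v) (E u v) = 0.
Proof.
  intros Huv. rewrite dot_comm. unfold frameE, normalize.
  rewrite dot_scal_l preE_eq // dot_plus_l !dot_scal_l dot_NuN //.
  rewrite (dot_comm (T u v)) dot_NT //. ring.
Qed.

Lemma dot_TE (u v : R) : U (u, v) -> dot (T u v) (E u v) = 0.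
Proof.
  intros Huv. rewrite dot_comm. unfold frameE, normalize.
  rewrite dot_scal_l preE_eq // dot_plus_l !dot_scal_l dot_NuT // dot_TT //. ring.
Qed.

Lemma Nu_eq (u v : R) : U (u, v) ->
  Du N u v = plus (scal (- kappa u v) (T u v)) (scal (- tau u v) (E u v)).
Proof.
  intros Huv.
  assert (k0 := kappa_neq0 u v Huv).
  assert (H := preE_eq u v Huv). rewrite -(preE_E u v Huv) in H.
  (* Pairing with E gives the norm as kappa <N_u, E> = - kappa <N, E_u>, which is - kappa tau; kappa
     can then be cancelled from the whole vector equation. *)
  assert (Ht : enorm (preE Omega N u v) = - kappa u v * tau u v).
  { assert (H1 := f_equal (fun X => dot X (E u v)) H).
    rewrite dot_plus_l (dot_scal_l (enorm _) (E u v)) (dot_scal_l (kappa u v))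
      (dot_scal_l (kappa u v ^ 2)) dot_EE // dot_TE // in H1.
    unfold tau_g1.
    rewrite (dot_comm (Du E u v))
      -(Ropp_involutive (dot (N u v) _))
      -(du_dot_const U N E 0 u v oU C1_N C1_E dot_NE Huv). lra. }
  rewrite Ht in H.
  (* Here i ranges over linear coordinate functions, so that the cancellation takes place in R. *)
  assert (Hi : forall i : E4 -> R, (forall x y, i (plus x y) = i x + i y) ->
    (forall a x, i (scal a x) = a * i x) ->
    i (Du N u v) = i (plus (scal (- kappa u v) (T u v)) (scal (- tau u v) (E u v)))).
  { intros i ip im. apply Rmult_eq_reg_l with (2 := k0).
    assert (H1 := f_equal i H). rewrite ip !im in H1. rewrite ip !im. lra. }
  apply E4_eq; now apply Hi.
Qed.

Lemma dot_DD (u v : R) : U (u, v) -> dot (D u v) (D u v) = 1.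
Proof.
  intros Huv. apply cross_orthonormal;
    [apply dot_NN | apply dot_TT | apply dot_EE | apply dot_NT | apply dot_NE
    | apply dot_TE]; exact Huv.
Qed.

Lemma dot_DN (u v : R) : dot (D u v) (N u v) = 0.
Proof. apply cross_dot_1. Qed.

Lemma dot_DT (u v : R) : dot (D u v) (T u v) = 0.
Proof. apply cross_dot_2. Qed.

Lemma dot_DE (u v : R) : dot (D u v) (E u v) = 0.
Proof. apply cross_dot_3. Qed.

Lemma dot_EuE (u v : R) : U (u, v) -> dot (Du E u v) (E u v) = 0.
Proof.
  intros Huv.
  assert (H := du_dot_const U E E 1 u v oU C1_E C1_E dot_EE Huv).
  rewrite (dot_comm (E u v)) in H. lra.
Qed.

(** All four components of D_u in the orthonormal frame are known by skew symmetry. Those on N and T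
    vanish because N_u and T_u have no D component, which leaves only the one on E. *)
Lemma Du_eq (u v : R) : U (u, v) -> Du D u v = scal (- sigma u v) (E u v).
Proof.
  intros Huv.
  assert (DuN : dot (Du D u v) (N u v) = 0).
  { rewrite (du_dot_const U D N 0 u v oU C1_D C1_N (fun u v _ => dot_DN u v) Huv).
    rewrite Nu_eq // dot_plus_r 2!dot_scal_r dot_DT dot_DE. ring. }
  assert (DuT : dot (Du D u v) (T u v) = 0).
  { rewrite (du_dot_const U D T 0 u v oU C1_D C1_T (fun u v _ => dot_DT u v) Huv).
    rewrite Tu_eq // dot_scal_r dot_DN. ring. }
  assert (DuE : dot (Du D u v) (E u v) = - sigma u v).
  { rewrite (du_dot_const U D E 0 u v oU C1_D C1_E (fun u v _ => dot_DE u v) Huv).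
    now rewrite dot_comm. }
  assert (DuD : dot (Du D u v) (D u v) = 0).
  { assert (H := du_dot_const U D D 1 u v oU C1_D C1_D dot_DD Huv).
    rewrite (dot_comm (D u v)) in H. lra. }
  assert (Hz : minus (Du D u v) (scal (- sigma u v) (E u v)) = zero).
  { apply (orthonormal_zero _ (N u v) (T u v) (E u v));
      [now apply dot_NN | now apply dot_TT | now apply dot_EE | now apply dot_NT
      | now apply dot_NE | now apply dot_TE | | | |];
      rewrite dot_minus_l dot_scal_l.
    - rewrite DuN (dot_comm (E u v)) dot_NE //. ring.
    - rewrite DuT (dot_comm (E u v)) dot_TE //. ring.
    - rewrite DuE dot_EE //. ring.
    - change (cross _ _ _) with (D u v).
      rewrite DuD (dot_comm (E u v)) dot_DE. ring. }
  apply plus_reg_r with (opp (scal (- sigma u v) (E u v))).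
  now rewrite plus_opp_r.
Qed.

(** * Derivatives in v under the Betchov-Da Rios equation *)

Hypothesis (tau_neq0 : forall u v, U (u, v) -> tau u v <> 0).
Hypothesis (BDR : Betchov_Da_Rios U Omega).

(** In T x kappa N x (kappa_u N - kappa^2 T - kappa tau E) only the E term survives alternation;
    interchanging T and N turns its sign into that of + W D. *)
Lemma Omega_v_eq (u v : R) : U (u, v) -> Dv Omega u v = scal (W u v) (D u v).
Proof.
  intros Huv. rewrite (BDR u v Huv) Omega_uuu_eq // Nu_eq //.
  change (Du (Du Omega) u v) with (Du T u v). rewrite Tu_eq //.
  change (Du Omega u v) with (T u v). unfold WW, frameD.
  generalize (T u v) (N u v) (E u v) (kappa u v) (tau u v) (du kappa u v).
  intros x y z k t ku.
  apply E4_eq; unfold cross, det4, det3, x1, x2, x3, x4; simpl;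
    unfold plus, scal; simpl; unfold mult; simpl; ring.
Qed.

Lemma C_W : class_C 3 U W.
Proof.
  assert (Ck : class_C 3 U kappa) by (apply class_C_le with (2 := C_kappa); lia).
  exact (class_C_mult _ _ _ _ oU (class_C_mult _ _ _ _ oU Ck
    (class_C_mult _ _ _ _ oU Ck (class_C_const U 3 1 oU))) C_tau).
Qed.

Lemma C1_W : class_C 1 U W.
Proof. apply class_C_le with (2 := C_W); lia. Qed.

Lemma C1_sigma : class_C 1 U sigma.
Proof. apply class_C_le with (2 := C_sigma); lia. Qed.

Lemma Tv_eq (u v : R) : U (u, v) ->
  Dv T u v = plus (scal (du W u v) (D u v)) (scal (- (W u v * sigma u v)) (E u v)).
Proof.
  intros Huv. change (Dv T u v) with (Dv (Du Omega) u v).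
  rewrite -(Du_Dv_comm U Omega u v oU) //;
    [|apply class_C_E4_le with (2 := C_Omega); lia].
  rewrite (Du_ext U _ (fun u v => scal (W u v) (D u v)) oU Omega_v_eq u v Huv).
  rewrite (Du_scal U W D u v C1_W C1_D Huv) Du_eq // scal_assoc.
  do 2 f_equal. unfold mult; simpl. ring.
Qed.

(** Since T_u = kappa N, the v-derivative is kappa_v N + kappa N_v; a vector orthogonal to N removes
    the unknown kappa_v. *)
Lemma kappa_Nv (X : E4) (u v : R) : U (u, v) -> dot (N u v) X = 0 ->
  kappa u v * dot (Dv N u v) X = dot (Du (Dv T) u v) X.
Proof.
  intros Huv NX.
  rewrite (Du_Dv_comm U T u v oU) //;
    [|apply class_C_E4_le with (2 := C_T); lia].
  rewrite (Dv_ext U _ (fun u v => scal (kappa u v) (N u v)) oU Tu_eq u v Huv).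
  rewrite (Dv_scal U kappa N u v) //;
    [|apply class_C_le with (2 := C_kappa); lia|exact C1_N].
  rewrite dot_plus_l 2!dot_scal_l NX. ring.
Qed.

Lemma C4_Nv : class_C_E4 4 U (Dv N).
Proof. exact (class_C_E4_Dv _ _ _ C_N). Qed.

Lemma C1_Tv : class_C_E4 1 U (Dv T).
Proof.
  apply class_C_E4_le with (2 := class_C_E4_Dv _ _ _ C_T); lia.
Qed.

Lemma dot_NvD (u v : R) : U (u, v) ->
  kappa u v * dot (Dv N u v) (D u v) = du (du W) u v - W u v * sigma u v ^ 2.
Proof.
  intros Huv. rewrite kappa_Nv //; [|rewrite dot_comm; apply dot_DN].
  assert (H := du_dot U (Dv T) D u v oU C1_Tv C1_D Huv).
  (* By [Tv_eq], <T_v, D> = W_u on U. Its u-derivative is W_uu, and the term <T_v, D_u> = W sigma^2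
     is then subtracted. *)
  rewrite (du_ext U _ (du W) oU) // in H.
  - rewrite Tv_eq // Du_eq // dot_scal_r dot_plus_l 2!dot_scal_l dot_DE
      dot_EE // in H. lra.
  - intros u' v' H'. rewrite Tv_eq // dot_plus_l 2!dot_scal_l dot_DD //.
    rewrite (dot_comm (E u' v')) dot_DE. ring.
Qed.

Lemma dot_NvE (u v : R) : U (u, v) ->
  kappa u v * dot (Dv N u v) (E u v) =
  - (2 * du W u v * sigma u v + W u v * du sigma u v).
Proof.
  intros Huv. rewrite kappa_Nv //; [|now apply dot_NE].
  assert (H := du_dot U (Dv T) E u v oU C1_Tv C1_E Huv).
  (* Here <T_v, E> = - W sigma, written as a product for [du_mult]. The second contribution W_u
     sigma comes from <T_v, E_u>, which explains the factor 2. *)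
  rewrite (du_ext U _ (fun u v => -1 * (W u v * sigma u v)) oU) // in H.
  - assert (CWs := class_C_mult _ _ _ _ oU C1_W C1_sigma).
    rewrite (du_mult U _ _ u v (class_C_const U 1 (-1) oU) CWs Huv)
      (du_mult U _ _ u v C1_W C1_sigma Huv) in H.
    assert (H0 : du (fun _ _ => -1) u v = 0) by exact (Derive_const (-1) u).
    rewrite H0 in H.
    rewrite Tv_eq // dot_plus_l 2!dot_scal_l (dot_comm (D u v) (Du E u v))
      (dot_comm (E u v) (Du E u v)) dot_EuE // in H.
    unfold kappa_g2 in *. lra.
  - intros u' v' H'. rewrite Tv_eq // dot_plus_l 2!dot_scal_l dot_EE // dot_DE. ring.
Qed.

(** Obtained by differentiating the relation for kappa <N_v, D> as a product, rather than a quotient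
    by kappa. *)
Lemma kappa_du_dot_NvD (u v : R) : U (u, v) ->
  kappa u v * du (fun u v => dot (Dv N u v) (D u v)) u v =
  du (du (du W)) u v - du W u v * sigma u v ^ 2
  - 2 * W u v * sigma u v * du sigma u v
  - du kappa u v * dot (Dv N u v) (D u v).
Proof.
  intros Huv.
  assert (Ck : class_C 1 U kappa) by (apply class_C_le with (2 := C_kappa); lia).
  assert (Ca : class_C 1 U (fun u v => dot (Dv N u v) (D u v))).
  { apply class_C_dot; [exact oU| |exact C1_D].
    apply class_C_E4_le with (2 := C4_Nv); lia. }
  assert (H := du_mult U _ _ u v Ck Ca Huv).
  rewrite (du_ext U _ _ oU dot_NvD u v Huv) in H.
  assert (ew := class_C_ex_du U _ u v C1_W Huv).
  assert (es := class_C_ex_du U _ u v C1_sigma Huv).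
  assert (ewuu := class_C_ex_du U _ u v
    (class_C_du _ _ _ (class_C_du _ _ _ C_W)) Huv).
  assert (H1 : du (fun u v => du (du W) u v - W u v * sigma u v ^ 2) u v =
    du (du (du W)) u v - du W u v * sigma u v ^ 2
      - 2 * W u v * sigma u v * du sigma u v).
  { apply is_derive_unique. auto_derive; [tauto|]. unfold du. ring. }
  rewrite H1 in H. lra.
Qed.

Lemma dot_Nuv_D (u v : R) : U (u, v) ->
  dot (Dv (Du N) u v) (D u v) =
  du (fun u v => dot (Dv N u v) (D u v)) u v
  + sigma u v * dot (Dv N u v) (E u v).
Proof.
  intros Huv.
  rewrite -(Du_Dv_comm U N u v oU) //;
    [|apply class_C_E4_le with (2 := C_N); lia].
  assert (C1 : class_C_E4 1 U (Dv N)) by (apply class_C_E4_le with (2 := C4_Nv); lia).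
  rewrite (du_dot U (Dv N) D u v oU C1 C1_D Huv) Du_eq // dot_scal_r. ring.
Qed.

(** N_u has no D component; differentiating <D, N_u> = 0 in v gives - <D, N_uv> = <D_v, N_u> = -
    kappa <D_v, T> - tau <D_v, E>, where <D_v, T> = - <D, T_v> = - W_u. *)
Lemma dot_DvE (u v : R) : U (u, v) ->
  tau u v * dot (Dv D u v) (E u v) =
  dot (Dv (Du N) u v) (D u v) + kappa u v * du W u v.
Proof.
  intros Huv.
  assert (C1 : class_C_E4 1 U (Du N)).
  { apply class_C_E4_le with (2 := class_C_E4_Du _ _ _ C_N); lia. }
  assert (DNu : forall u v, U (u, v) -> dot (D u v) (Du N u v) = 0).
  { intros u' v' H'. rewrite Nu_eq // dot_plus_r 2!dot_scal_r dot_DT dot_DE. ring. }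
  assert (H := dv_dot_const U D (Du N) 0 u v oU C1_D C1 DNu Huv).
  assert (H1 := dv_dot_const U D T 0 u v oU C1_D C1_T (fun u v _ => dot_DT u v) Huv).
  rewrite Nu_eq // dot_plus_r 2!dot_scal_r H1 Tv_eq // dot_plus_r 2!dot_scal_r dot_DD //
    dot_DE in H.
  rewrite (dot_comm _ (D u v)). lra.
Qed.

(** * The second fundamental form and the invariants of gamma *)

Lemma C1_Omega_v : class_C_E4 1 U (Dv Omega).
Proof.
  apply class_C_E4_le with (2 := class_C_E4_Dv _ _ _ C_Omega); lia.
Qed.

(** Omega_v = W D is orthogonal to N, so the v-derivative can be moved onto N without producing
    W_v. *)
Lemma c22_N (u v : R) : U (u, v) ->
  c22 Omega N u v = - (W u v * dot (Dv N u v) (D u v)).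
Proof.
  intros Huv. unfold c22.
  rewrite (dv_dot_const U (Dv Omega) N 0 u v oU C1_Omega_v C1_N) //.
  - rewrite Omega_v_eq // dot_scal_l. now rewrite (dot_comm (D u v)).
  - intros u' v' H'. rewrite Omega_v_eq // dot_scal_l dot_DN. ring.
Qed.

(** The derivative is moved from Omega_v onto E and then, through <D, E> = 0, back onto D; again W_v
    is avoided. *)
Lemma c22_E (u v : R) : U (u, v) ->
  c22 Omega E u v = W u v * dot (Dv D u v) (E u v).
Proof.
  intros Huv. unfold c22.
  rewrite (dv_dot_const U (Dv Omega) E 0 u v oU C1_Omega_v C1_E) //.
  - rewrite Omega_v_eq // dot_scal_l.
    rewrite (dv_dot_const U D E 0 u v oU C1_D C1_E (fun u v _ => dot_DE u v) Huv). ring.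
  - intros u' v' H'. rewrite Omega_v_eq // dot_scal_l dot_DE. ring.
Qed.

Lemma c11_E (u v : R) : U (u, v) -> c11 Omega E u v = 0.
Proof.
  intros Huv. unfold c11. change (Du (Du Omega) u v) with (Du T u v).
  rewrite Tu_eq // dot_scal_l dot_NE //. ring.
Qed.

Lemma c12_E (u v : R) : U (u, v) -> c12 Omega E u v = - (W u v * sigma u v).
Proof.
  intros Huv. unfold c12. change (Dv (Du Omega) u v) with (Dv T u v).
  rewrite Tv_eq // dot_plus_l 2!dot_scal_l dot_DE dot_EE //. ring.
Qed.

Lemma c12_N (u v : R) : U (u, v) -> c12 Omega N u v = 0.
Proof.
  intros Huv. unfold c12. change (Dv (Du Omega) u v) with (Dv T u v).
  rewrite Tv_eq // dot_plus_l 2!dot_scal_l dot_DN (dot_comm (E u v)) dot_NE //. ring.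
Qed.

Lemma W_neq0 (u v : R) : U (u, v) -> W u v <> 0.
Proof.
  intros Huv. apply Rmult_integral_contrapositive_currified;
    [now apply pow_nonzero, kappa_neq0 | now apply tau_neq0].
Qed.

Lemma g12_eq (u v : R) : U (u, v) -> g12 Omega u v = 0.
Proof.
  intros Huv. unfold g12. change (Du Omega u v) with (T u v).
  rewrite Omega_v_eq // dot_scal_r dot_comm dot_DT. ring.
Qed.

Lemma g22_eq (u v : R) : U (u, v) -> g22 Omega u v = W u v ^ 2.
Proof.
  intros Huv. unfold g22.
  now rewrite Omega_v_eq // dot_scal_r dot_scal_l dot_DD.
Qed.

Lemma l11_eq (u v : R) : U (u, v) -> l11 Omega N u v = 2 * kappa u v * sigma u v.
Proof.
  intros Huv. unfold l11, Delta1. rewrite c11_E // c12_E // c12_N //.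
  change (c11 Omega N u v) with (kappa u v). field. now apply W_neq0.
Qed.

Lemma l12_eq (u v : R) : U (u, v) ->
  l12 Omega N u v = - (kappa u v * dot (Dv D u v) (E u v)).
Proof.
  intros Huv. unfold l12, Delta2. rewrite c11_E // c22_E //.
  change (c11 Omega N u v) with (kappa u v). field. now apply W_neq0.
Qed.

Lemma l22_eq (u v : R) : U (u, v) ->
  l22 Omega N u v = 2 * W u v * sigma u v * dot (Dv N u v) (D u v).
Proof.
  intros Huv. unfold l22, Delta3. rewrite c12_E // c12_N // c22_N //.
  field. now apply W_neq0.
Qed.

(** With g11 = 1, g12 = 0 and g22 = W^2, the determinant of gamma reduces to (l11 l22 - l12^2) /
    W^2. *)
Lemma invariant_k_eq (u v : R) : U (u, v) ->
  invariant_k Omega N u v =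
  (4 * kappa u v * W u v * sigma u v ^ 2 * dot (Dv N u v) (D u v)
   - kappa u v ^ 2 * dot (Dv D u v) (E u v) ^ 2) / W u v ^ 2.
Proof.
  intros Huv. unfold invariant_k, gamma_11, gamma_12, gamma_21, gamma_22.
  rewrite g12_eq // g22_eq // l11_eq // l12_eq // l22_eq //.
  change (g11 Omega u v) with (dot (T u v) (T u v)). rewrite dot_TT //.
  field. now apply W_neq0.
Qed.

(** In the same orthogonal coordinates, h = (l11 + l22 / W^2) / 2. *)
Lemma invariant_h_eq (u v : R) : U (u, v) ->
  invariant_h Omega N u v =
  sigma u v * (kappa u v + dot (Dv N u v) (D u v) / W u v).
Proof.
  intros Huv. unfold invariant_h, gamma_11, gamma_22.
  rewrite g12_eq // g22_eq // l11_eq // l22_eq //.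
  change (g11 Omega u v) with (dot (T u v) (T u v)). rewrite dot_TT //.
  field. now apply W_neq0.
Qed.

End Frame.

(* Class C^7 is the least for which all derivatives in the formula for the first
   invariant exist: the third u-derivative of tau_g1 involves seven derivatives of Omega. As N is
   Omega_uu / kappa_n, C^5 is then its natural class. *)
Theorem theorem2 :
  forall (U : R * R -> Prop) (Omega N : R -> R -> E4),
    open U ->
    class_C_E4 7 U Omega ->
    class_C_E4 5 U N ->
    ED2_frame_field U Omega N ->
    (forall u v, U (u, v) -> kappa_n Omega N u v <> 0) ->
    (forall u v, U (u, v) -> tau_g1 Omega N u v <> 0) ->
    Betchov_Da_Rios U Omega ->
    forall u v : R, U (u, v) ->
      let k := kappa_n Omega N u v in
      let ku := du (kappa_n Omega N) u v in
      let kuu := du (du (kappa_n Omega N)) u v in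
      let kuuu := du (du (du (kappa_n Omega N))) u v in
      let s := kappa_g2 Omega N u v in
      let su := du (kappa_g2 Omega N) u v in
      let t := tau_g1 Omega N u v in
      let tu := du (tau_g1 Omega N) u v in
      let tuu := du (du (tau_g1 Omega N)) u v in
      let tuuu := du (du (du (tau_g1 Omega N))) u v in
      let P :=
        k ^ 5 * tu + 2 * k ^ 4 * t * ku - 2 * t * ku ^ 3
        + 2 * k * ku * (ku * tu + 2 * t * kuu) + k ^ 3 * tuuu
        + k ^ 2 * (5 * ku * tuu + 6 * tu * kuu + 2 * t * kuuu) in
      let Q :=
        4 * k ^ 3 * t ^ 3 * (4 * ku * tu + k * tuu)
        + 8 * k ^ 2 * t ^ 4 * (ku ^ 2 + k * kuu)
        + 6 * k ^ 2 * tu *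
            (k ^ 4 * tu + 2 * ku ^ 2 * tu + k ^ 2 * tuuu
             + k * (5 * ku * tuu + 6 * tu * kuu))
        + t ^ 2 *
            (- 20 * ku ^ 4 - k ^ 4 * (9 * su ^ 2 - 20 * ku ^ 2)
             + 40 * k * ku ^ 2 * kuu + 20 * k ^ 2 * ku * kuuu)
        + 2 * k * t *
            (11 * k ^ 4 * ku * tu + 4 * ku ^ 3 * tu
             + k * ku * (25 * ku * tuu + 42 * tu * kuu)
             + k ^ 2 * (5 * ku * tuuu + 6 * tu * kuuu)) in
      invariant_k Omega N u v =
        - 1 / (k ^ 6 * t ^ 4) *
          (6 * k ^ 5 * t * s ^ 3 * su * (3 * k * tu + 5 * t * ku)
           + k ^ 4 * s ^ 4 *
               (4 * k ^ 2 * t ^ 4 + 9 * k ^ 2 * tu ^ 2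
                + 30 * k * t * ku * tu + 25 * t ^ 2 * ku ^ 2)
           - 6 * k ^ 3 * t * s * su * P + P ^ 2 - k ^ 2 * s ^ 2 * Q)
      /\
      invariant_h Omega N u v =
        s * ((- k ^ 2 * s ^ 2 + k ^ 4 + 2 * ku ^ 2 + 2 * k * kuu) * t
             + (4 * ku * tu + k * tuu) * k)
        / (k ^ 3 * t).
Proof.
  intros U Omega N oU C_Omega C_N frame k0 t0 BDR u v Huv
    k ku kuu kuuu s su t tu tuu tuuu P Q.
  assert (hk : k <> 0) by now apply k0.
  assert (ht : t <> 0) by now apply t0.
  assert (Ck : class_C 3 U (kappa_n Omega N)).
  { apply class_C_le with (2 := C_kappa U Omega N oU C_Omega C_N). lia. }
  assert (Ct := C_tau U Omega N oU C_Omega C_N frame).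
  assert (Wu : du (WW Omega N) u v = 2 * k * ku * t + k ^ 2 * tu).
  { apply (du_square_mult U (kappa_n Omega N) (tau_g1 Omega N) oU); [| |exact Huv].
    - apply class_C_le with (2 := Ck). lia.
    - apply class_C_le with (2 := Ct). lia. }
  assert (Wuu : du (du (WW Omega N)) u v =
    2 * ku ^ 2 * t + 2 * k * kuu * t + 4 * k * ku * tu + k ^ 2 * tuu).
  { apply (du2_square_mult U (kappa_n Omega N) (tau_g1 Omega N) oU); [| |exact Huv].
    - apply class_C_le with (2 := Ck). lia.
    - apply class_C_le with (2 := Ct). lia. }
  assert (Wuuu : du (du (du (WW Omega N))) u v =
    6 * ku * kuu * t + 2 * k * kuuu * t + 6 * ku ^ 2 * tu + 6 * k * kuu * tu
    + 6 * k * ku * tuu + k ^ 2 * tuuu)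
    by exact (du3_square_mult U (kappa_n Omega N) (tau_g1 Omega N) oU Ck Ct u v Huv).
  (* The four unknown v-quantities; a and b are rational in the u-derivatives of W and sigma, au
     depends on a, and d depends on au and b. *)
  set (a := dot (Dv N u v) (frameD Omega N u v)).
  set (b := dot (Dv N u v) (frameE Omega N u v)).
  set (au := du (fun u v => dot (Dv N u v) (frameD Omega N u v)) u v).
  set (d := dot (Dv (frameD Omega N) u v) (frameE Omega N u v)).
  assert (Ha : a = (du (du (WW Omega N)) u v - k ^ 2 * t * s ^ 2) / k).
  { apply Rmult_eq_reg_l with (2 := hk).
    etransitivity; [exact (dot_NvD U Omega N oU C_Omega C_N frame k0 BDR u v Huv)|].
    change (WW Omega N u v) with (k ^ 2 * t). fold s. field. exact hk. }
  assert (Hb : b = - (2 * du (WW Omega N) u v * s + k ^ 2 * t * su) / k).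
  { apply Rmult_eq_reg_l with (2 := hk).
    etransitivity; [exact (dot_NvE U Omega N oU C_Omega C_N frame k0 BDR u v Huv)|].
    change (WW Omega N u v) with (k ^ 2 * t). fold s su. field. exact hk. }
  assert (Hau : au = (du (du (du (WW Omega N))) u v - du (WW Omega N) u v * s ^ 2
                      - 2 * (k ^ 2 * t) * s * su - ku * a) / k).
  { apply Rmult_eq_reg_l with (2 := hk).
    etransitivity;
      [exact (kappa_du_dot_NvD U Omega N oU C_Omega C_N frame k0 BDR u v Huv)|].
    change (WW Omega N u v) with (k ^ 2 * t). fold s su ku a. field. exact hk. }
  assert (Hd : d = (au + s * b + k * du (WW Omega N) u v) / t).
  { apply Rmult_eq_reg_l with (2 := ht).
    etransitivity; [exact (dot_DvE U Omega N oU C_Omega C_N frame k0 BDR u v Huv)|].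
    rewrite (dot_Nuv_D U Omega N oU C_Omega C_N frame k0 u v Huv).
    fold s k au b. field. exact ht. }
  rewrite (invariant_k_eq U Omega N oU C_Omega C_N frame k0 t0 BDR u v Huv)
    (invariant_h_eq U Omega N oU C_Omega C_N frame k0 t0 BDR u v Huv).
  fold a d s k. change (WW Omega N u v) with (k ^ 2 * t).
  (* The order follows these dependencies and ends with the derivatives of W in terms of kappa and
     tau. *)
  rewrite Hd Hau Hb Ha Wu Wuu Wuuu.
  (* With their bodies cleared, the values of kappa, sigma, tau and their derivatives are
     independent variables, and both formulas are identities of rational functions with denominators
     powers of k and t. *)
  unfold P, Q. clearbody k ku kuu kuuu s su t tu tuu tuuu.
  split; field; auto.
Qed.
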